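(* Let $\mathcal V_{\rm matter}$ be a vertex algebra with a Hamiltonian $\widehat{\mathfrak g}_{-2h^\vee}$ action such that $C(\widehat{\mathfrak g}_{-2h^\vee},\mathfrak g,\mathcal V_{\rm matter})$ satisfies the $\mathbf Q^-\mathbf Q^+$ lemma. Then the ${\rm U}(1)$ action on relative semi-infinite cohomology with weight spaces $H^{\frac\infty2+d}(\widehat{\mathfrak g}_{-2h^\vee},\mathfrak g,\mathcal V_{\rm matter})$, $d\in\mathbb Z$, extends to an action of ${\rm USp}(2)$ by vertex algebra automorphisms.
   Context: Vertex algebras are over $\mathbb C$ and may have Grassmann-odd elements; $Y(x,z)=\sum_{n\in\mathbb Z}x_nz^{-n-1}$; $[\,,]$ is the graded commutator; repeated indices are summed. $\mathfrak g_c$ is the Lie algebra of a compact Lie group, $\mathfrak g=\mathfrak g_c\otimes\mathbb C$, $\{T_A\}$ a basis of $\mathfrak g_c$ with $[T_A,T_B]=f_{AB}^CT_C$, $\kappa$ a nondegenerate invariant bilinear form on $\mathfrak g_c$ restricting to the Killing form on simple factors (normalized so long roots have squared length 2), $K_{AB}=\kappa(T_A,T_B)$, $K^{AB}$ its inverse, $f_{ABC}=f^D_{AB}K_{DC}$. A Hamiltonian $\widehat{\mathfrak g}_{-2h^\vee}$ action on $\mathcal V_{\rm matter}$ is a vertex algebra homomorphism from the universal affine vertex algebra of $\mathfrak g$ (level $-2h^\vee$ for each simple factor, $0$ on the centre), $J_A(z)J_B(w)\sim\frac{kK_{AB}}{(z-w)^2}+\frac{f_{AB}^CJ_C(w)}{z-w}$;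 $J_A$ also denotes the images of the generators. ${\rm Sf}[\mathbb C^2\otimes\mathfrak g]$ is the vertex algebra freely generated by odd fields $\eta^{\pm,A}$ with $[\eta^{\alpha,A}_n,\eta^{\beta,B}_m]=n\epsilon^{\alpha\beta}K^{AB}\delta_{n+m,0}$, $\epsilon^{+-}=1=-\epsilon^{-+}$. $\mathfrak g$ acts on it by derivations $\theta_A:\eta^{\alpha,B}\mapsto-f_{AC}^B\eta^{\alpha,C}$. Put $$C(\widehat{\mathfrak g}_{-2h^\vee},\mathfrak g,\mathcal V_{\rm matter})=\{x\in\mathcal V_{\rm matter}\otimes{\rm Sf}[\mathbb C^2\otimes\mathfrak g]:(J_{A,0}+\theta_A)x=0\ \forall A\}.$$ Let $\Lambda$ be the even derivation, zero on $\mathcal V_{\rm matter}$, with $\Lambda\eta^{-,A}=\eta^{+,A}$, $\Lambda\eta^{+,A}=0$. On $C(\dots)$ there are two square-zero, mutually anticommuting odd derivations $$\mathbf Q^-=\sum_{n\ne0}\tfrac1n\eta^{-,A}_{-n}J_{A,n}+\sum_{m,n\ne0,\,m\ne n}\tfrac{f_{ABC}}{2mn}:\!\eta^{-,A}_{-n}\eta^{-,B}_m\eta^{+,C}_{n-m}\!:,\qquad\mathbf Q^+:=[\Lambda,\mathbf Q^-].$$ $C(\dots)$ is graded by $\eta^-$-degree minus $\eta^+$-degree ($\mathcal V_{\rm matter}$ in degree $0$), so $\mathbf Q^-$ has degree $+1$; $H^{\frac\infty2+d}(\widehat{\mathfrak g}_{-2h^\vee},\mathfrak g,\mathcal V_{\rm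 matter})$ is the degree-$d$ part of the cohomology of $(C(\dots),\mathbf Q^-)$, and $e^{\mathrm i\theta}\in{\rm U}(1)$ acts on it by $e^{\mathrm id\theta}$. ${\rm U}(1)$ is regarded as the diagonal torus of ${\rm USp}(2)\cong{\rm SU}(2)$. $C(\dots)$ satisfies the $\mathbf Q^-\mathbf Q^+$ lemma if: whenever $x$ satisfies $\mathbf Q^-x=0=\mathbf Q^+x$ and ($x=\mathbf Q^-x'$ or $x=\mathbf Q^+x'$ for some $x'$ in $C(\dots)$), there is $\widetilde x\in C(\dots)$ with $x=\mathbf Q^-\mathbf Q^+\widetilde x$. *)

(* Defs.v *)
From HB Require Import structures.
From mathcomp Require Import all_boot all_order all_algebra.
From mathcomp Require Import spectral complex.
From mathcomp Require Import all_classical all_reals all_analysis.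
Import Order.TTheory GRing.Theory Num.Theory.
Import numFieldNormedType.Exports.

Set Implicit Arguments.
Unset Strict Implicit.
Unset Printing Implicit Defensive.

Local Open Scope classical_set_scope.
Local Open Scope complex_scope.
Local Open Scope ring_scope.

(* The ground field of vertex algebras is [R[i]] for [R : realType], i.e. the
    complex numbers. Infinite sums are the finite-support sums
    [\sum_(i \in A) F i] of mathcomp-classical (equal to 0 by convention when
    the support is infinite, which never happens below). *)

(* binom(n, j) = n (n - 1) ... (n - j + 1) / j!, for n of any sign *)
Definition zbin (K : fieldType) (n : int) (j : nat) : K :=
  (\prod_(i < j) (n - i%:Z)%:~R) / (j`!)%:R.

(* [vmode a n b] is a_n b, where Y(a, z) = \sum_n a_n z^(-n-1);
   [vpar false] and [vpar true] are the even and the odd subspaces. The last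
   axiom is the Borcherds identity. *)
Record vertexAlgebra (R : realType) := VertexAlgebra {
  vspc :> lmodType R[i];
  vpar : bool -> vspc -> Prop;
  vac : vspc;
  vmode : vspc -> int -> vspc -> vspc;
  vparD : forall p (c : R[i]) x y, vpar p x -> vpar p y -> vpar p (c *: x + y);
  vpar0 : forall p, vpar p 0;
  vpar_dec : forall x, exists x0 x1,
    [/\ vpar false x0, vpar true x1 & x = x0 + x1];
  vpar_dir : forall x, vpar false x -> vpar true x -> x = 0;
  vpar_vac : vpar false vac;
  vpar_mode : forall p q n x y,
    vpar p x -> vpar q y -> vpar (p (+) q) (vmode x n y);
  vmode_linl : forall n (c : R[i]) x x' y,
    vmode (c *: x + x') n y = c *: vmode x n y + vmode x' n y;
  vmode_linr : forall n (c : R[i]) x y y',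
    vmode x n (c *: y + y') = c *: vmode x n y + vmode x n y';
  vmode_trunc : forall x y, exists N : int, forall n, N <= n -> vmode x n y = 0;
  vac_mode : forall n x, vmode vac n x = if n == - 1 then x else 0;
  mode_vac : forall x, vmode x (- 1) vac = x;
  mode_vac0 : forall n x, 0 <= n -> vmode x n vac = 0;
  vborcherds : forall p q a b c (k m n : int), vpar p a -> vpar q b ->
    \sum_(j \in [set: nat])
       zbin R[i] m j *: vmode (vmode a (n + j%:Z) b) (m + k - j%:Z) c
    = \sum_(j \in [set: nat]) ((- 1) ^+ j * zbin R[i] n j) *:
       (vmode a (m + n - j%:Z) (vmode b (k + j%:Z) c)
        - ((- 1) ^ n * (- 1) ^+ (p && q)) *:
            vmode b (n + k - j%:Z) (vmode a (m + j%:Z) c))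
}.

Section VertexAlgebras.
Variable R : realType.
Local Notation C := R[i].
Implicit Types U V W S H : vertexAlgebra R.

Definition va_hom V W (f : V -> W) : Prop :=
  [/\ forall (c : C) x y, f (c *: x + y) = c *: f x + f y,
      forall p x, vpar p x -> vpar p (f x),
      f (vac V) = vac W
    & forall x n y, f (vmode x n y) = vmode (f x) n (f y)].

Definition va_automorphism V (f : V -> V) : Prop := va_hom f /\ bijective f.

Definition even_derivation V (D : V -> V) : Prop :=
  [/\ forall (c : C) x y, D (c *: x + y) = c *: D x + D y,
      forall p x, vpar p x -> vpar p (D x)
    & forall x n y, D (vmode x n y) = vmode (D x) n y + vmode x n (D y)].

(* Poincare-Birkhoff-Witt monomials: the letter (i, n) stands for the mode of
   index -(n+1) of the i-th generator. *)
Definition pbw_monomial (I : finType) V (a : I -> V) (l : seq (I * nat)) : V :=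
  foldr (fun p x => vmode (a p.1) (- (p.2.+1)%:Z) x) (vac V) l.

Definition pbw_order (I : finType) (odd_gen : I -> bool) (p q : I * nat) :=
  [|| (q.2 < p.2)%N,
      (p.2 == q.2) && (enum_rank p.1 < enum_rank q.1)%N
    | (p == q) && ~~ odd_gen p.1].

(* V is freely generated by the homogeneous elements a_i: the ordered monomials
   (without repetition of odd letters) form a basis of V. *)
Definition freely_generated (I : finType) (odd_gen : I -> bool) V (a : I -> V)
  : Prop :=
  [/\ forall i, vpar (odd_gen i) (a i),
      forall x : V, exists (L : seq (seq (I * nat)))
                           (c : seq (I * nat) -> C),
        all (sorted (pbw_order odd_gen)) L /\
        x = \sum_(l <- L) c l *: pbw_monomial a l
    & forall (L : seq (seq (I * nat))) (c : seq (I * nat) -> C),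
        uniq L -> all (sorted (pbw_order odd_gen)) L ->
        \sum_(l <- L) c l *: pbw_monomial a l = 0 ->
        forall l, l \in L -> c l = 0].

(* W, with i and j, is the tensor product vertex algebra of V and S, where
   i v = v \otimes vac, j s = vac \otimes s and
   v \otimes s = (i v)_{-1} (j s). The last clause is the universal property of
   the tensor product of vector spaces. *)
Definition va_tensor V S W (i : V -> W) (j : S -> W) : Prop :=
  [/\ va_hom i,
      va_hom j,
      forall p q v s m n x, vpar p v -> vpar q s ->
        vmode (i v) m (vmode (j s) n x)
        = (- 1) ^+ (p && q) *: vmode (j s) n (vmode (i v) m x)
    & forall (P : lmodType C) (b : V -> S -> P),
        (forall c v v' s, b (c *: v + v') s = c *: b v s + b v' s) ->
        (forall c v s s', b v (c *: s + s') = c *: b v s + b v s') ->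
        exists h : {linear W -> P},
          (forall v s, h (vmode (i v) (- 1) (j s)) = b v s) /\
          (forall h' : {linear W -> P},
             (forall v s, h' (vmode (i v) (- 1) (j s)) = b v s) -> h' =1 h)].

(* H, with pi, is the vertex algebra Z / B: Z is a vertex subalgebra of W and
   pi is a surjective homomorphism Z -> H with kernel B (the values of pi
   outside Z are irrelevant). *)
Definition va_subquotient W (Z B : W -> Prop) H (pi : W -> H) : Prop :=
  ([/\ forall (c : C) x y, Z x -> Z y -> Z (c *: x + y),
       Z (vac W)
     & forall x n y, Z x -> Z y -> Z (vmode x n y)])
  /\
  ([/\ forall (c : C) x y, Z x -> Z y -> pi (c *: x + y) = c *: pi x + pi y,
       forall p x, Z x -> vpar p x -> vpar p (pi x),
       pi (vac W) = vac H
     & forall x n y, Z x -> Z y -> pi (vmode x n y) = vmode (pi x) n (pi y)])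
  /\
  (forall h, exists2 x, Z x & pi x = h)
  /\
  (forall x, B x <-> Z x /\ pi x = 0).

End VertexAlgebras.

Section LieAlgebras.
Variables (F : fieldType) (d : nat).
Implicit Type f : 'I_d -> 'I_d -> 'I_d -> F.

(* A Lie algebra with a basis T_A, [T_A, T_B] = \sum_C f A B C T_C, is handled
   in coordinates: its elements are row vectors, its subspaces are row spaces
   of matrices. *)
Definition lie_ad f (x : 'rV[F]_d) : 'M[F]_d :=
  \matrix_(B, C) \sum_A x 0 A * f A B C.

Definition lie_br f (x y : 'rV[F]_d) : 'rV[F]_d := y *m lie_ad f x.

Definition killing f (x y : 'rV[F]_d) : F := \tr (lie_ad f x *m lie_ad f y).

Definition bform (M : 'M[F]_d) (x y : 'rV[F]_d) : F := (x *m M *m y^T) 0 0.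

Definition invariant_form f (M : 'M[F]_d) : Prop :=
  forall x y z, bform M (lie_br f x y) z = bform M x (lie_br f y z).

Definition is_centre f (z : 'M[F]_d) : Prop :=
  forall x : 'rV_d, (x <= z)%MS <-> forall y, lie_br f x y = 0.

Definition simple_ideal f (s : 'M[F]_d) : Prop :=
  [/\ forall x y : 'rV_d, (y <= s)%MS -> (lie_br f x y <= s)%MS,
      exists x y : 'rV_d,
        [/\ (x <= s)%MS, (y <= s)%MS & lie_br f x y <> 0]
    & forall u : 'M[F]_d, (u <= s)%MS ->
        (forall x y : 'rV_d,
           (x <= s)%MS -> (y <= u)%MS -> (lie_br f x y <= u)%MS) ->
        u = 0 \/ (s <= u)%MS].

Definition reductive_decomposition f (z : 'M[F]_d) (r : nat)
    (s : 'I_r -> 'M[F]_d) : Prop :=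
  [/\ is_centre f z,
      forall i, simple_ideal f (s i),
      (1%:M <= z + \sum_i s i)%MS
    & mxdirect (z + \sum_i s i)].

End LieAlgebras.

Section CompactLieAlgebras.
Variable R : realType.
Local Notation C := R[i].

Definition compact_matrix_group n (G : set 'M[R]_n) : Prop :=
  [/\ compact G,
      G 1%:M,
      forall g h, G g -> G h -> G (g *m h)
    & forall g, G g -> g \in unitmx /\ G (invmx g)].

(* X is tangent at the identity to a one-parameter subgroup of G *)
Definition lie_of n (G : set 'M[R]_n) (X : 'M[R]_n) : Prop :=
  exists gam : R -> 'M[R]_n,
    [/\ forall t, G (gam t),
        forall s t, gam (s + t) = gam s *m gam t
      & forall i j, is_derive (0 : R) (1 : R) (fun t => gam t i j) (X i j)].

(* Compact Lie groups are taken as compact groups of matrices (every compact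
   Lie group is isomorphic to one). *)
Definition compact_lie_basis n (G : set 'M[R]_n) d (T : 'I_d -> 'M[R]_n)
    (f : 'I_d -> 'I_d -> 'I_d -> R) : Prop :=
  [/\ forall X, lie_of G X <-> exists c : 'I_d -> R, X = \sum_A c A *: T A,
      forall c : 'I_d -> R, \sum_A c A *: T A = 0 -> forall A, c A = 0
    & forall A B, T A *m T B - T B *m T A = \sum_D f A B D *: T D].

Variable d : nat.
Variables (f : 'I_d -> 'I_d -> 'I_d -> R) (K : 'M[R]_d).

Definition cstruct (A B D : 'I_d) : C := (f A B D)%:C.
Definition cmx (M : 'M[R]_d) : 'M[C]_d := map_mx (fun x : R => x%:C) M.

Definition maximal_abelian (s t : 'M[R]_d) : Prop :=
  [/\ (t <= s)%MS,
      forall x y : 'rV_d, (x <= t)%MS -> (y <= t)%MS -> lie_br f x y = 0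
    & forall x : 'rV_d, (x <= s)%MS ->
        (forall y : 'rV_d, (y <= t)%MS -> lie_br f x y = 0) -> (x <= t)%MS].

(* a is the element of the Cartan subalgebra t \otimes C of s \otimes C that
   corresponds, under K, to a root: the root is h |-> K(a, h), and its squared
   length is K(a, a). *)
Definition is_root (s t : 'M[R]_d) (a : 'rV[C]_d) : Prop :=
  [/\ (a <= cmx t)%MS, a <> 0
    & exists x : 'rV[C]_d,
        [/\ (x <= cmx s)%MS, x <> 0
          & forall h : 'rV[C]_d, (h <= cmx t)%MS ->
              lie_br cstruct h x = bform (cmx K) a h *: x]].

Definition long_roots_length2 (s : 'M[R]_d) : Prop :=
  forall t, maximal_abelian s t ->
    (forall a, is_root s t a -> bform (cmx K) a a <= 2) /\
    (exists2 a, is_root s t a & bform (cmx K) a a = 2).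

Definition normalized_invariant_form : Prop :=
  [/\ K^T = K,
      K \in unitmx,
      invariant_form f K
    & forall s, simple_ideal f s ->
        (exists c : R, forall x y : 'rV_d, (x <= s)%MS -> (y <= s)%MS ->
           bform K x y = c * killing f x y)
        /\ long_roots_length2 s].

(* For K normalized as above, the dual Coxeter number of the simple factor s is
   half of the eigenvalue of the Casimir element K^{AB} T_A T_B on s. *)
Definition dual_coxeter (s : 'M[R]_d) (h : R) : Prop :=
  forall x : 'rV_d, (x <= s)%MS ->
    \sum_A \sum_B invmx K A B *:
       lie_br f (delta_mx 0 A) (lie_br f (delta_mx 0 B) x) = (2 * h) *: x.

(* lam is the form k K of level k = - 2 h^\vee on each simple factor and k = 0
   on the centre (distinct factors are K-orthogonal by invariance). *)
Definition critical_level_form (lam : 'M[R]_d) : Prop :=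
  exists (z : 'M[R]_d) (r : nat) (s : 'I_r -> 'M[R]_d) (h : 'I_r -> R),
    [/\ reductive_decomposition f z s,
        forall i, dual_coxeter (s i) (h i),
        forall i (x y : 'rV_d), (x <= s i)%MS ->
          bform lam x y = - 2 * h i * bform K x y
      & forall x y : 'rV_d, (x <= z)%MS ->
          bform lam x y = 0 /\ bform lam y x = 0].

(* U is the universal affine vertex algebra with
   J_A(z) J_B(w) ~ lam_{AB} / (z - w)^2 + f_{AB}^D J_D(w) / (z - w) *)
Definition universal_affine (lam : 'M[R]_d) (U : vertexAlgebra R)
    (J : 'I_d -> U) : Prop :=
  freely_generated (fun=> false) J /\
  (forall A B,
     [/\ vmode (J A) 0 (J B) = \sum_D cstruct A B D *: J D,
         vmode (J A) 1 (J B) = (lam A B)%:C *: vac U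
       & forall n : int, 2 <= n -> vmode (J A) n (J B) = 0]).

(* The index alpha = + is [true], alpha = - is [false]. *)
Definition eps (a b : bool) : C :=
  if a == b then 0 else if a then 1 else - 1.

Definition symplectic_fermions (S : vertexAlgebra R)
    (eta : bool * 'I_d -> S) : Prop :=
  freely_generated (fun=> true) eta /\
  (forall a b A B (n m : int) x,
     vmode (eta (a, A)) n (vmode (eta (b, B)) m x)
     + vmode (eta (b, B)) m (vmode (eta (a, A)) n x)
     = (n%:~R * eps a b * (invmx K A B)%:C * (n + m == 0)%:R) *: x).

(* f_{ABC} *)
Definition flow (A B D : 'I_d) : R := \sum_E f A B E * K E D.

Section Complex.
Variables (W : vertexAlgebra R) (J : 'I_d -> W) (eta : bool * 'I_d -> W).
Variables (theta : 'I_d -> W -> W) (Lam : W -> W).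

Definition is_theta (V : vertexAlgebra R) (i : V -> W) : Prop :=
  forall A, [/\ even_derivation (theta A),
                forall v, theta A (i v) = 0
              & forall a B, theta A (eta (a, B))
                            = - \sum_D cstruct A D B *: eta (a, D)].

Definition is_Lambda (V : vertexAlgebra R) (i : V -> W) : Prop :=
  [/\ even_derivation Lam,
      forall v, Lam (i v) = 0,
      forall A, Lam (eta (false, A)) = eta (true, A)
    & forall A, Lam (eta (true, A)) = 0].

Definition relC (x : W) : Prop :=
  forall A, vmode (J A) 0 x + theta A x = 0.

(* Normally ordered product of modes of eta's, the letter (a, A, n) standing for
   eta^{a,A}_n: modes with n < 0 are moved to the left of those with n >= 0,
   with a sign for each transposition. *)
Fixpoint nord (l : seq (bool * 'I_d * int)) (x : W) : W :=
  if l is (a, n) :: l' then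
    if n < 0 then vmode (eta a) n (nord l' x)
    else (- 1) ^+ size l' *: nord l' (vmode (eta a) n x)
  else x.

Definition Qminus (x : W) : W :=
  \sum_(n \in [set n : int | n != 0])
     \sum_A (n%:~R)^-1 *: vmode (eta (false, A)) (- n) (vmode (J A) n x)
  + \sum_(p \in [set p : int * int | [&& p.1 != 0, p.2 != 0 & p.1 != p.2]])
     (let m := p.1 in let n := p.2 in
      \sum_A \sum_B \sum_D
        ((flow A B D)%:C / (2 * m%:~R * n%:~R)) *:
        nord [:: (false, A, - n); (false, B, m); (true, D, n - m)] x).

Definition Qplus (x : W) : W := Lam (Qminus x) - Qminus (Lam x).

Definition QQ_lemma : Prop :=
  forall x, relC x -> Qminus x = 0 -> Qplus x = 0 ->
    (exists2 x', relC x' & x = Qminus x') \/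
    (exists2 x', relC x' & x = Qplus x') ->
    exists2 y, relC y & x = Qminus (Qplus y).

(* The grading by eta^- degree minus eta^+ degree: elements of degree k are the
   combinations of products of modes of eta^- and eta^+, applied to elements
   of the matter factor, with k more eta^-'s than eta^+'s. *)
Inductive eta_degree (V : vertexAlgebra R) (i : V -> W) : int -> W -> Prop :=
| eta_degree_matter v : eta_degree i 0 (i v)
| eta_degree_minus k A n x :
    eta_degree i k x -> eta_degree i (k + 1) (vmode (eta (false, A)) n x)
| eta_degree_plus k A n x :
    eta_degree i k x -> eta_degree i (k - 1) (vmode (eta (true, A)) n x)
| eta_degree_lin k (c : C) x y :
    eta_degree i k x -> eta_degree i k y -> eta_degree i k (c *: x + y).

Definition cocycle (x : W) : Prop := relC x /\ Qminus x = 0.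
Definition coboundary (x : W) : Prop := exists2 y, relC y & x = Qminus y.

Definition relative_cohomology (H : vertexAlgebra R) (pi : W -> H) : Prop :=
  va_subquotient cocycle coboundary pi.

Definition cohomology_degree (V : vertexAlgebra R) (i : V -> W)
    (H : vertexAlgebra R) (pi : W -> H) (k : int) (h : H) : Prop :=
  exists x, [/\ cocycle x, eta_degree i k x & pi x = h].

End Complex.
End CompactLieAlgebras.

Section USp2.
Variable R : realType.
Local Notation C := R[i].

Definition symp2 : 'M[C]_2 :=
  \matrix_(i, j) if i == j then 0 else if i == 0 then 1 else - 1.

Definition usp2 : set 'M[C]_2 :=
  [set g | g \is unitarymx /\ g^T *m symp2 *m g = symp2].

Definition torus2 (t : C) : 'M[C]_2 :=
  \matrix_(i, j) if i != j then 0 else if i == 0 then t else t^-1.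

(* An action of the Lie group USp(2) by vertex algebra automorphisms. The last
   clause is continuity: every vector lies in a finite-dimensional subspace in
   which its orbit map is continuous ([C^o] carries the usual topology). *)
Definition usp2_action (H : vertexAlgebra R) (rho : 'M[C]_2 -> H -> H) : Prop :=
  [/\ forall g, usp2 g -> va_automorphism (rho g),
      forall h, rho 1%:M h = h,
      forall g g' h, usp2 g -> usp2 g' -> rho (g *m g') h = rho g (rho g' h)
    & forall h, exists (k : nat) (e : 'I_k -> H)
                       (c : 'I_k -> 'M[C^o]_2 -> C^o),
        (forall i, {within (usp2 : set 'M[C^o]_2), continuous (c i)}) /\
        (forall g, usp2 g -> rho g h = \sum_i (c i g : C) *: e i)].

End USp2.

(* Main.v *)
Require Import Defs.
From HB Require Import structures.
From mathcomp Require Import all_boot all_order all_algebra.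
From mathcomp Require Import spectral complex.
From mathcomp Require Import ring zify.
From mathcomp Require Import all_classical all_reals all_analysis.
Import Order.TTheory GRing.Theory Num.Theory.
Import numFieldNormedType.Exports.
Set Implicit Arguments.
Unset Strict Implicit.
Unset Printing Implicit Defensive.
Local Open Scope classical_set_scope.
Local Open Scope complex_scope.
Local Open Scope ring_scope.

(** The group SL(2) acts on the complex by vertex algebra automorphisms that fix
    the matter factor and mix the two kinds of fermions: the relations of the
    symplectic fermions involve their sign index only through the symplectic
    form, so every symplectic change of generators extends to an automorphism
    ([rotation_exists], [rotation_hom]). Freeness of the fermions
    ([free_fermion_universal]) and the universal property of the tensor product
    give the underlying linear map; that it respects all modes is checked on
    generators ([complex_ind]).

    Under this action the differentials [Q^-] and [Q^+] form a doublet
    ([rotation_Qminus]). This is evident for the term linear in the fermions.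
    The cubic term lies a priori in the sum of spins 3/2 and 1/2, and its spin
    3/2 part vanishes: the three modes [p1], [p2], [p3] of a cubic monomial add
    up to zero, so that [1 / (p1 p2) + 1 / (p2 p3) + 1 / (p3 p1) = 0], and the
    structure constants and normally ordered products are cyclically symmetric
    ([cubic_cyclic]).

    Since [Q^-] squares to zero on the relative subspace, so does every rotated
    [Q^-], whence [Q^+] squares to zero and anticommutes with [Q^-]. By the
    [Q^- Q^+] lemma the cohomology of [Q^-] is then the intersection of the two
    kernels modulo the image of [Q^- Q^+] ([bicocycle_rep], [exact_Rot]). The
    intersection of the kernels is stable under SL(2) because the differentials
    form a doublet, and [Q^- Q^+] is a singlet because rotations have determinant
    one. So SL(2), and with it USp(2), acts on the cohomology; its diagonal torus
    acts on a product of fermions by the degree. Orbits are polynomial in the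
    matrix entries ([orbit_coefficients]), which gives continuity. *)

(** * Linear maps and sums of finite support *)

Section LinearMaps.
Variable (K : fieldType).

Definition lin (U V : lmodType K) (g : U -> V) : Prop :=
  forall (c : K) x y, g (c *: x + y) = c *: g x + g y.

Variables (U V : lmodType K) (g : U -> V) (hg : lin g).

Lemma linD x y : g (x + y) = g x + g y.
Proof. by have := hg 1 x y; rewrite !scale1r. Qed.

Lemma lin0 : g 0 = 0.
Proof. by apply: (addrI (g 0)); rewrite -linD !addr0. Qed.

Lemma linZ c x : g (c *: x) = c *: g x.
Proof. by have := hg c x 0; rewrite lin0 !addr0. Qed.

Lemma linN x : g (- x) = - g x.
Proof. by rewrite -scaleN1r linZ scaleN1r. Qed.

Lemma linB x y : g (x - y) = g x - g y.
Proof. by rewrite linD linN. Qed.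

Lemma lin_sum (I : Type) (r : seq I) (P : pred I) (F : I -> U) :
  g (\sum_(i <- r | P i) F i) = \sum_(i <- r | P i) g (F i).
Proof. by apply: (big_morph g linD lin0). Qed.

End LinearMaps.

Section LinearClosure.
Variable (K : fieldType).

Lemma lin_comp (U V W : lmodType K) (g : V -> W) (h : U -> V) :
  lin g -> lin h -> lin (g \o h).
Proof. by move=> hg hh c x y; rewrite /= hh hg. Qed.

Definition lin_closed (U : lmodType K) (P : U -> Prop) : Prop :=
  forall (c : K) x y, P x -> P y -> P (c *: x + y).

Variables (U : lmodType K) (P : U -> Prop).
Hypothesis (hP : lin_closed P) (hP0 : P 0).

Lemma lin_closedZ c x : P x -> P (c *: x).
Proof. by move=> Px; rewrite -[_ *: _]addr0; apply: hP. Qed.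

Lemma lin_closedD x y : P x -> P y -> P (x + y).
Proof. by move=> Px Py; rewrite -[x]scale1r; apply: hP. Qed.

Lemma lin_closed_sum (I : Type) (r : seq I) (Q : pred I) (F : I -> U) :
  (forall i, Q i -> P (F i)) -> P (\sum_(i <- r | Q i) F i).
Proof. by move=> PF; apply: big_ind => // x y; apply: lin_closedD. Qed.

End LinearClosure.

Section FiniteSupport.
Variables (K : fieldType) (U : lmodType K) (I : choiceType) (A : set I).
Implicit Types F G : I -> U.

(** A sequence containing the support, rather than finiteness of a set, is what
    lets several sums be rewritten over one common range. *)
Definition fin_supp F : Prop :=
  exists r : seq I, forall i, A i -> i \notin r -> F i = 0.

Lemma fsum_seq (V : lmodType K) (r : seq I) (F : I -> V) :
  (forall i, A i -> i \notin r -> F i = 0) ->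
  \sum_(i \in A) F i = \sum_(i <- undup r | i \in A) F i.
Proof.
move=> h; rewrite [RHS]bigfs ?undup_uniq ?set_mem_set // => i.
by rewrite inE mem_undup; apply: h.
Qed.

Lemma fin_supp_comb c F G :
  fin_supp F -> fin_supp G -> fin_supp (fun i => c *: F i + G i).
Proof.
move=> [r hr] [s hs]; exists (r ++ s) => i Ai.
by rewrite mem_cat negb_or => /andP[ir si]; rewrite hr ?hs // scaler0 addr0.
Qed.

Lemma fsum_lin (V : lmodType K) (g : U -> V) F : lin g -> fin_supp F ->
  g (\sum_(i \in A) F i) = \sum_(i \in A) g (F i).
Proof.
move=> hg [r hr]; rewrite (fsum_seq hr) (lin_sum hg) (@fsum_seq _ r) //.
by move=> i Ai ir; rewrite hr ?(lin0 hg).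
Qed.

Lemma fsum_comb c F G : fin_supp F -> fin_supp G ->
  \sum_(i \in A) (c *: F i + G i)
  = c *: (\sum_(i \in A) F i) + \sum_(i \in A) G i.
Proof.
move=> [r hr] [s hs].
have hr' i : A i -> i \notin r ++ s -> F i = 0.
  by move=> Ai; rewrite mem_cat negb_or => /andP[ir si]; rewrite hr.
have hs' i : A i -> i \notin r ++ s -> G i = 0.
  by move=> Ai; rewrite mem_cat negb_or => /andP[ir si]; rewrite hs.
rewrite (fsum_seq hr') (fsum_seq hs') (@fsum_seq _ (r ++ s)); last first.
  by move=> i Ai irs; rewrite hr' ?hs' // scaler0 addr0.
by rewrite scaler_sumr big_split.
Qed.

Lemma fsum_sum (T : Type) (r : seq T) (u : T -> K) (G : T -> I -> U) :
  (forall t, fin_supp (G t)) ->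
  \sum_(i \in A) \sum_(t <- r) u t *: G t i
  = \sum_(t <- r) u t *: \sum_(i \in A) G t i.
Proof.
move=> hG; suff [] : fin_supp (fun i => \sum_(t <- r) u t *: G t i) /\
  \sum_(i \in A) \sum_(t <- r) u t *: G t i
  = \sum_(t <- r) u t *: \sum_(i \in A) G t i by [].
elim: r => [|t r [IH1 IH2]].
  split; first by exists [::] => *; rewrite big_nil.
  by rewrite big_nil fsbig1 // => i _; rewrite big_nil.
have e : (fun i => \sum_(t' <- t :: r) u t' *: G t' i) =
  (fun i => u t *: G t i + \sum_(t' <- r) u t' *: G t' i).
  by apply/funext => i; rewrite big_cons.
split; first by rewrite e; apply: fin_supp_comb.
under eq_fsbigr do rewrite big_cons.
by rewrite fsum_comb // big_cons IH2.
Qed.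

End FiniteSupport.

Lemma fsum_nat (K : fieldType) (U : lmodType K) N (F : nat -> U) :
  (forall j, (N <= j)%N -> F j = 0) ->
  \sum_(j \in [set: nat]) F j = \sum_(j < N) F j.
Proof.
move=> h; rewrite (@fsum_seq _ _ _ _ (iota 0 N)); last first.
  by move=> j _; rewrite mem_iota add0n /= -leqNgt; apply: h.
rewrite undup_id ?iota_uniq // -{1}[N]subn0 -[iota _ _]/(index_iota 0 N).
by rewrite big_mkord; apply: eq_bigl => j; rewrite in_setT.
Qed.

(** * Modes of a vertex algebra *)

Section Modes.
Variables (R : realType).
Local Notation C := R[i].
Variable W : vertexAlgebra R.
Implicit Types (a b c x y : W) (m n k : int).

Lemma vmode_lin a n : lin (vmode a n : W -> W).
Proof. by move=> c x y; apply: vmode_linr. Qed.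

Lemma vmodel_lin n y : lin (fun x : W => vmode x n y).
Proof. by move=> c x x'; apply: vmode_linl. Qed.

Definition vmodeDr a n := linD (vmode_lin a n).
Definition vmodeZr a n := linZ (vmode_lin a n).
Definition vmodeNr a n := linN (vmode_lin a n).
Definition vmode0r a n := lin0 (vmode_lin a n).
Definition vmode_sumr a n := lin_sum (vmode_lin a n).

Lemma vmodeDl n x x' y : vmode (x + x') n y = vmode x n y + vmode x' n y.
Proof. exact: (linD (vmodel_lin n y)). Qed.
Lemma vmodeZl n (t : C) x y : vmode (t *: x) n y = t *: vmode x n y.
Proof. exact: (linZ (vmodel_lin n y)). Qed.
Lemma vmode0l n y : vmode 0 n y = 0.
Proof. exact: (lin0 (vmodel_lin n y)). Qed.
Lemma vmode_suml n y (I : Type) (r : seq I) (P : pred I) (F : I -> W) :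
  vmode (\sum_(i <- r | P i) F i) n y = \sum_(i <- r | P i) vmode (F i) n y.
Proof. exact: (lin_sum (vmodel_lin n y)). Qed.

Lemma zbin0 m : zbin C m 0 = 1.
Proof. by rewrite /zbin big_ord0 fact0 divr1. Qed.

Lemma zbin0S j : zbin C 0 j.+1 = 0.
Proof. by rewrite /zbin big_ord_recl subr0 mul0r mul0r. Qed.

Lemma vpar_closed p : lin_closed (vpar p : W -> Prop).
Proof. by move=> c x y; apply: vparD. Qed.

(** The instance [m = 0] of the Borcherds identity: it expresses the modes of
    [a_n b] by those of [a] and [b], so that what is compatible with the modes
    of generators is compatible with all modes. *)
Lemma vmode_iterate p q a b c n k : vpar p a -> vpar q b ->
  exists N0 : nat, forall N : nat, (N0 <= N)%N ->
  vmode (vmode a n b) k c = \sum_(j < N) ((- 1) ^+ j * zbin C n j) *: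
       (vmode a (n - j%:Z) (vmode b (k + j%:Z) c)
        - ((- 1) ^ n * (- 1) ^+ (p && q)) *:
            vmode b (n + k - j%:Z) (vmode a j%:Z c)).
Proof.
move=> ha hb; have [N1 h1] := vmode_trunc b c; have [N2 h2] := vmode_trunc a c.
exists (maxn `|N1 - k|%N `|N2|%N) => N hN.
have := vborcherds c k 0 n ha hb.
rewrite (@fsum_nat _ _ 1%N); last by case=> // j _; rewrite zbin0S scale0r.
rewrite big_ord1 zbin0 scale1r addr0 add0r subr0 => ->.
rewrite (@fsum_nat _ _ N) => [|j jN].
  by apply: eq_bigr => j _; rewrite !add0r.
rewrite h1 ?h2 ?vmode0r ?scaler0 ?subr0 ?scaler0 //.
  rewrite add0r; apply: le_trans (ler_norm _) _.
  by rewrite -abszE lez_nat; apply: leq_trans jN; rewrite (leq_trans _ hN) ?leq_maxr.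
rewrite -lerBlDl; apply: le_trans (ler_norm _) _.
by rewrite -abszE lez_nat; apply: leq_trans jN; rewrite (leq_trans _ hN) ?leq_maxl.
Qed.

End Modes.

(** * Spanning by pure tensors *)

Section Tensor.
Variables (R : realType).
Local Notation C := R[i].
Variables (V S W : vertexAlgebra R) (i : V -> W) (j : S -> W).
Hypothesis hW : va_tensor i j.

Definition tens v s : W := vmode (i v) (- 1) (j s).

Lemma tens_linl s : lin (tens^~ s).
Proof. by case: hW => -[hi _ _ _] _ _ _ c v v'; rewrite /tens hi vmode_linl. Qed.

Lemma tens_linr v : lin (tens v).
Proof. by case: hW => _ [hj _ _ _] _ _ c s s'; rewrite /tens hj vmode_linr. Qed.

(** The values in a linear subspace containing the pure tensors define a bilinear
    map into that subspace, hence a linear map from [W]. Composed with the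
    inclusion it agrees with the identity on pure tensors, so it is the identity
    and the subspace is everything. *)
Section Span.
Variable (P : W -> Prop).
Hypothesis (hP : lin_closed P) (hPt : forall v s, P (tens v s)).

Let P0 : P 0.
Proof. by have := hPt 0 0; rewrite (lin0 (tens_linr 0)). Qed.

Definition span_pred (x : W) : bool := `[< P x >].

Fact span_submod : submod_closed span_pred.
Proof.
split=> [|c x y]; first exact/asboolP.
by move=> /asboolP Px /asboolP Py; apply/asboolP/hP.
Qed.
HB.instance Definition _ := GRing.isSubmodClosed.Build C W span_pred span_submod.

Record span_sub := SpanSub { span_val :> W; span_valP : span_val \in span_pred }.
HB.instance Definition _ := [isSub for span_val].
HB.instance Definition _ := [Choice of span_sub by <:].
HB.instance Definition _ := [SubChoice_isSubLmodule of span_sub by <:].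

Fact tens_span v s : tens v s \in span_pred. Proof. exact/asboolP. Qed.

Lemma tens_ind x : P x.
Proof.
pose b v s := SpanSub (tens_span v s).
have hl c v v' s : b (c *: v + v') s = c *: b v s + b v' s.
  by apply: val_inj; rewrite [RHS]linearP /= (tens_linl s).
have hr c v s s' : b v (c *: s + s') = c *: b v s + b v s'.
  by apply: val_inj; rewrite [RHS]linearP /= (tens_linr v).
case: hW => _ _ _ univ.
have [h [hb _]] := univ _ b hl hr.
have [h1 [_ uniq1]] := univ W tens (fun c v v' s => tens_linl s c v v')
   (fun c v s s' => tens_linr v c s s').
have vlin : linear (fun x => val (h x) : W).
  by move=> c y z; rewrite !linearP.
pose h2 : {linear W -> W} := HB.pack (fun x => val (h x) : W)
  (GRing.isLinear.Build _ _ _ _ _ vlin).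
have e2 : h2 =1 h1 by apply: uniq1 => v s; rewrite /= hb.
have e1 : (idfun : {linear W -> W}) =1 h1 by apply: uniq1.
have -> : x = val (h x) by rewrite -[LHS]/(idfun x) e1 -e2.
exact/asboolP/(valP (h x)).
Qed.

End Span.
End Tensor.

(** * The universal property of free fermions *)

Section AnticommutingWords.
Variables (K : fieldType) (L : eqType).
Hypothesis K2 : 2%:R != 0 :> K.

Definition anticommuting (X : lmodType K) (op : L -> X -> X) : Prop :=
  (forall p, lin (op p)) /\ forall p q x, op p (op q x) = - op q (op p x).

Lemma word_move (X : lmodType K) (op : L -> X -> X) p l1 l2 x :
  anticommuting op ->
  foldr op x (l1 ++ p :: l2) = (- 1) ^+ size l1 *: op p (foldr op x (l1 ++ l2)).
Proof.
move=> [ol oa]; elim: l1 => [|q l1 IH] /=; first by rewrite expr0 scale1r.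
by rewrite IH (linZ (ol q)) oa exprS mulN1r scaleNr scalerN.
Qed.

(** The sign [s] is chosen before the operators, so that the same reordering can
    be performed on the source and on the target of a map. *)
Lemma word_perm l l' : perm_eq l l' -> exists s : K,
  forall (X : lmodType K) (op : L -> X -> X) x, anticommuting op ->
  foldr op x l = s *: foldr op x l'.
Proof.
elim: l l' => [|p l IH] l' hp.
  by exists 1 => X op x _; rewrite scale1r; case: l' hp => // a l' /perm_size.
have pl' : p \in l' by rewrite -(perm_mem hp) mem_head.
case/splitPr: pl' hp => l1 l2 hp.
have {}hp : perm_eq l (l1 ++ l2).
  by move: hp; rewrite perm_sym -(cat1s p l2) perm_catCA /= perm_cons perm_sym.
have [s hs] := IH _ hp.
exists (s * (- 1) ^+ size l1) => X op x ho /=.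
rewrite (word_move _ _ _ _ ho) scalerA -mulrA -expr2 sqrr_sign mulr1.
by rewrite (hs _ _ _ ho) (linZ (proj1 ho p)).
Qed.

Lemma word_nuniq (X : lmodType K) (op : L -> X -> X) l x :
  anticommuting op -> ~~ uniq l -> foldr op x l = 0.
Proof.
move=> ho; elim: l => //= p l IH; rewrite negb_and negbK => /orP[]; last first.
  by move=> /IH ->; rewrite (lin0 (proj1 ho p)).
case/splitPr=> l1 l2; rewrite (word_move _ _ _ _ ho) (linZ (proj1 ho p)).
set y := foldr _ _ _; suff -> : op p (op p y) = 0 by rewrite scaler0.
have /eqP := proj2 ho p p y; rewrite -subr_eq0 opprK -mulr2n -scaler_nat.
by rewrite scaler_eq0 (negPf K2) => /eqP.
Qed.

End AnticommutingWords.

Section PBW.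
Variables (R : realType).
Local Notation C := R[i].
Variables (I : finType).
Local Notation letter := (I * nat)%type.
Local Notation ord := (pbw_order (fun _ : I => true)).

Lemma pbw_le_total : total (fun p q : letter => (p == q) || ord p q).
Proof.
move=> [i n] [j m]; rewrite /pbw_order /= !andbF !orbF !xpair_eqE.
case: (ltngtP n m) => [_|_|_]; rewrite ?orbT //=.
case: (ltngtP (enum_rank i) (enum_rank j)); rewrite ?orbT //= => /val_inj.
by move=> /enum_rank_inj ->; rewrite !eqxx.
Qed.

Lemma pbw_le_trans : transitive (fun p q : letter => (p == q) || ord p q).
Proof.
move=> q p r /orP[/eqP->//|pq] /orP[/eqP<-|qr]; first by rewrite pq orbT.
apply/orP; right; move: pq qr; rewrite /pbw_order !andbF !orbF.
case/orP=> [h1|/andP[/eqP e1 h1]] /orP[h2|/andP[/eqP e2 h2]].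
- by rewrite (ltn_trans h2 h1).
- by rewrite -e2 h1.
- by rewrite e1 h2.
- by rewrite e1 e2 eqxx (ltn_trans h1 h2) orbT.
Qed.

(** Sorting costs a sign, and a word with a repeated letter vanishes; again [s]
    and [l'] serve all families of operators at once. *)
Lemma word_normal_form (l : seq letter) : exists (s : C) l', sorted ord l' /\
  forall (X : lmodType C) (op : letter -> X -> X) x, anticommuting op ->
  foldr op x l = s *: foldr op x l'.
Proof.
have C2 : 2%:R != 0 :> C by rewrite pnatr_eq0.
case: (boolP (uniq l)) => ul; last first.
  by exists 0, [::]; split=> // X op x ho; rewrite scale0r (word_nuniq C2).
pose le p q := (p == q) || ord p q.
have hp : perm_eq l (sort le l) by rewrite perm_sym perm_sort.
have [s hs] := word_perm C hp; exists s, (sort le l); split=> //.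
apply: pairwise_sorted.
have : pairwise le (sort le l).
  by rewrite -(sorted_pairwise pbw_le_trans); apply/sort_sorted/pbw_le_total.
have : uniq (sort le l) by rewrite sort_uniq.
rewrite uniq_pairwise => h1 h2.
have := pairwise_relI [rel p q | p != q] le (sort le l); rewrite h1 h2 /=.
by apply: sub_pairwise => p q /= /andP[/negPf pq]; rewrite /le pq.
Qed.

Variables (S : vertexAlgebra R) (a : I -> S).
Hypothesis (hfree : freely_generated (fun=> true) a).
Variable gam : I -> I -> int -> int -> C.
Hypothesis gam_neg : forall p q n m, n < 0 -> m < 0 -> gam p q n m = 0.
Hypothesis hS : forall p q n m x,
  vmode (a p) n (vmode (a q) m x) + vmode (a q) m (vmode (a p) n x)
  = gam p q n m *: x.

Variables (M : lmodType C) (e : I -> int -> M -> M) (v0 : M).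
Hypothesis (e_lin : forall p n, lin (e p n)).
Hypothesis hM : forall p q n m x,
  e p n (e q m x) + e q m (e p n x) = gam p q n m *: x.
Hypothesis e_vac : forall p n, 0 <= n -> e p n v0 = 0.

Definition creation (p : letter) : M -> M := e p.1 (- (p.2.+1)%:Z).

Lemma creation_anticommuting : anticommuting creation.
Proof.
split=> [p|p q x]; first exact: e_lin.
apply/eqP; rewrite -subr_eq0 opprK /creation hM gam_neg ?scale0r //;
by rewrite oppr_lt0.
Qed.

Lemma pbw_anticommuting :
  anticommuting (fun p : letter => vmode (a p.1) (- (p.2.+1)%:Z) : S -> S).
Proof.
split=> [p|p q x]; first exact: vmode_lin.
apply/eqP; rewrite -subr_eq0 opprK hS gam_neg ?scale0r //;
by rewrite oppr_lt0.
Qed.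

(** Formal linear combinations of words are lists of terms in which words may be
    repeated: sums of combinations are then concatenations. *)
Definition eval_terms (X : lmodType C) (m : seq letter -> X)
  (s : seq (C * seq letter)) : X := \sum_(t <- s) t.1 *: m t.2.

Lemma eval_termsE (X : lmodType C) (m : seq letter -> X) s :
  eval_terms m s = \sum_(l <- undup (map snd s))
    (\sum_(t <- s | t.2 == l) t.1) *: m l.
Proof.
under [RHS]eq_bigr => l _ do rewrite scaler_suml.
rewrite (exchange_big_dep predT) //= /eval_terms big_seq [RHS]big_seq.
apply: eq_bigr => t ts.
under eq_bigl do rewrite eq_sym.
rewrite -big_filter filter_pred1_uniq ?undup_uniq ?big_seq1 //.
by rewrite mem_undup map_f.
Qed.

(** Linear independence of the sorted monomials, for combinations with repeated
    words: prescribing values on the monomials is consistent. *)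
Lemma eval_terms0 (m : seq letter -> M) s :
  all (fun t => sorted ord t.2) s -> eval_terms (pbw_monomial a) s = 0 ->
  eval_terms m s = 0.
Proof.
move=> hs; rewrite !eval_termsE => h0; rewrite big_seq big1 // => l ll.
have [_ _ hind] := hfree.
rewrite (hind _ (fun l => \sum_(t <- s | t.2 == l) t.1) _ _ h0) //.
- by rewrite scale0r.
- exact: undup_uniq.
- apply/allP => l'; rewrite mem_undup => /mapP[t ts ->].
  exact: (allP hs).
Qed.

(** The value is prescribed on sorted words. It is the expected one on all words,
    because creation operators are reordered in the same way in [S] and in [M];
    so the map commutes with creation operators, and annihilation operators are
    moved to the vacuum by the common anticommutators [gam]. *)
Theorem free_fermion_universal : exists F : S -> M,
  [/\ lin F, F (vac S) = v0 & forall p n x, F (vmode (a p) n x) = e p n (F x)].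
Proof.
pose m l := foldr creation v0 l.
have [_ hspan _] := hfree.
have /choice[rep hrep] : forall x, exists s,
    all (fun t => sorted ord t.2) s /\ x = eval_terms (pbw_monomial a) s.
  move=> x; have [L [c [hL ->]]] := hspan x.
  exists [seq (c l, l) | l <- L]; rewrite all_map; split=> //.
  by rewrite /eval_terms big_map.
pose F x := eval_terms m (rep x).
have FE s x : all (fun t => sorted ord t.2) s ->
    x = eval_terms (pbw_monomial a) s -> F x = eval_terms m s.
  move=> hs hx; have [hr hxr] := hrep x.
  pose s' := s ++ [seq (- t.1, t.2) | t <- rep x].
  have es (X : lmodType C) (mm : seq letter -> X) :
      eval_terms mm s' = eval_terms mm s - eval_terms mm (rep x).
    rewrite /eval_terms big_cat big_map /= -sumrN; congr (_ + _).
    by apply: eq_bigr => t _; rewrite scaleNr.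
  have : eval_terms m s' = 0.
    apply: eval_terms0; first by rewrite all_cat hs all_map.
    by rewrite es -hx -hxr subrr.
  by rewrite es => /eqP; rewrite subr_eq0 => /eqP.
have Flin : lin F.
  move=> c x y; have [hx ex] := hrep x; have [hy ey] := hrep y.
  have es (X : lmodType C) (mm : seq letter -> X) :
      eval_terms mm ([seq (c * t.1, t.2) | t <- rep x] ++ rep y)
      = c *: eval_terms mm (rep x) + eval_terms mm (rep y).
    rewrite /eval_terms big_cat big_map /= scaler_sumr; congr (_ + _).
    by apply: eq_bigr => t _; rewrite scalerA.
  rewrite (FE ([seq (c * t.1, t.2) | t <- rep x] ++ rep y)) ?es -?ex -?ey //.
  by rewrite all_cat hy all_map andbT.
have Fword l : F (pbw_monomial a l) = m l.
  have [s [l' [hl' nf]]] := word_normal_form l.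
  rewrite /pbw_monomial (nf _ _ _ pbw_anticommuting) (linZ Flin).
  rewrite -/(pbw_monomial a l') (FE [:: (1, l')]).
  - by rewrite /eval_terms big_seq1 scale1r /m (nf _ _ _ creation_anticommuting).
  - by rewrite /= hl'.
  - by rewrite /eval_terms big_seq1 scale1r.
have ext (g h : S -> M) : lin g -> lin h ->
    (forall l, g (pbw_monomial a l) = h (pbw_monomial a l)) -> g =1 h.
  move=> hg hh e0 x; have [L [c [_ ->]]] := hspan x.
  rewrite (lin_sum hg) (lin_sum hh); apply: eq_bigr => l _.
  by rewrite (linZ hg) (linZ hh) e0.
have Fcre p n x : F (vmode (a p) (- (n.+1)%:Z) x) = e p (- (n.+1)%:Z) (F x).
  apply: (ext (F \o vmode (a p) (- (n.+1)%:Z)) (e p (- (n.+1)%:Z) \o F)).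
  - exact/lin_comp/vmode_lin.
  - exact: lin_comp.
  - by move=> l /=; rewrite -[vmode _ _ _]/(pbw_monomial a ((p, n) :: l)) !Fword.
have Fvac : F (vac S) = v0 by rewrite -[vac S]/(pbw_monomial a [::]) Fword.
exists F; split=> // p n.
apply: (ext (F \o vmode (a p) n) (e p n \o F)).
- exact/lin_comp/vmode_lin.
- exact: lin_comp.
case: (ltP n 0) => hn l /=.
  have -> : n = - (`|n|%N.-1.+1)%:Z.
    by rewrite prednK ?absz_gt0 ?lt_eqF // abszE ltr0_norm // opprK.
  exact: Fcre.
elim: l => [|q l IH]; first by rewrite Fword mode_vac0 //= e_vac // (lin0 Flin).
rewrite /= -/(pbw_monomial a l).
have -> : vmode (a p) n (vmode (a q.1) (- (q.2.+1)%:Z) (pbw_monomial a l)) =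
   gam p q.1 n (- (q.2.+1)%:Z) *: pbw_monomial a l
   - vmode (a q.1) (- (q.2.+1)%:Z) (vmode (a p) n (pbw_monomial a l)).
  by rewrite -hS addrK.
rewrite (linB Flin) (linZ Flin) !Fcre IH.
by apply/eqP; rewrite subr_eq hM.
Qed.

Lemma free_ind (P : S -> Prop) : lin_closed P -> P (vac S) ->
  (forall p n x, P x -> P (vmode (a p) n x)) -> forall x, P x.
Proof.
move=> hP Pv Pm x; have [_ hspan _] := hfree.
have P0 : P 0 by rewrite -(addNr (vac S)) -scaleN1r; apply: hP.
have [L [c [_ ->]]] := hspan x.
apply: (lin_closed_sum hP P0) => l _; apply: (lin_closedZ hP P0).
by elim: l => //= p l; apply: Pm.
Qed.

End PBW.

(** * The action of SL(2) on the complex *)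

Section Parity.
Variables (R : realType) (W : vertexAlgebra R).

Lemma vpar_split (x0 x1 : W) p : vpar false x0 -> vpar true x1 ->
  vpar p (x0 + x1) -> x0 + x1 = if p then x1 else x0.
Proof.
move=> h0 h1; case: p => hp.
  suff -> : x0 = 0 by rewrite add0r.
  apply: (vpar_dir h0); rewrite -(addrK x1 x0) -scaleN1r addrC.
  exact: vparD.
suff -> : x1 = 0 by rewrite addr0.
apply: vpar_dir h1; rewrite -(addKr x0 x1) -scaleN1r.
exact: vparD.
Qed.

End Parity.

Section Rotations.
Variable R : realType.
Local Notation C := R[i].

(** The first coordinate of [C^2] belongs to [eta^-] and the second to [eta^+], so
    that the torus acts on [eta^-] with weight one. *)
Definition idx (b : bool) : 'I_2 := if b then 1 else 0.

Definition sp2 (g : 'M[C]_2) : Prop := g^T *m symp2 R *m g = symp2 R.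

Lemma big_idx (X : nmodType) (F : 'I_2 -> X) :
  \sum_(k < 2) F k = \sum_(c : bool) F (idx c).
Proof.
rewrite big_bool /= addrC big_ord_recl big_ord1 /=.
by congr (F _ + F _); apply: val_inj.
Qed.

Lemma sp2_eps g a b : sp2 g ->
  \sum_(c : bool) \sum_(c' : bool)
    g (idx c) (idx a) * g (idx c') (idx b) * eps R c c' = eps R a b.
Proof.
have symE c c' : symp2 R (idx c) (idx c') = - eps R c c'.
  by case: c c' => -[]; rewrite !mxE /eps /= ?oppr0 ?opprK.
move=> /matrixP/(_ (idx a) (idx b)); rewrite symE => h.
apply: oppr_inj; rewrite -h exchange_big -sumrN mxE big_idx; apply: eq_bigr => c' _.
rewrite mxE big_idx mulr_suml -sumrN; apply: eq_bigr => c _.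
by rewrite [_^T _ _]mxE symE mulrN mulNr mulrAC.
Qed.

Lemma sp2_det g : sp2 g -> g 0 0 * g 1 1 - g 1 0 * g 0 1 = 1.
Proof.
move=> hg; have := sp2_eps false true hg.
rewrite !big_bool /eps /= !(mulr0, add0r, addr0) mulr1 mulrN1 => h.
by rewrite -[RHS]opprK -h opprB.
Qed.

(** The columns of [g] are the images of the generators; this makes rotations
    compose in the order of the matrix product. *)
Definition rot d (X : lmodType C) (g : 'M[C]_2) (e : bool * 'I_d -> X)
  (p : bool * 'I_d) : X := \sum_(c : bool) g (idx c) (idx p.1) *: e (c, p.2).

Lemma rot_mul d (X : lmodType C) (g h : 'M[C]_2) (e : bool * 'I_d -> X) :
  rot (g *m h) e =1 rot h (rot g e).
Proof.
move=> p; rewrite /rot /=.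
under eq_bigr do rewrite mxE big_idx scaler_suml.
under [RHS]eq_bigr do rewrite scaler_sumr.
rewrite exchange_big; apply: eq_bigr => c _; apply: eq_bigr => c' _.
by rewrite scalerA mulrC.
Qed.

Lemma rot1 d (X : lmodType C) (e : bool * 'I_d -> X) : rot 1%:M e =1 e.
Proof. by case=> -[] A; rewrite /rot big_bool !mxE /= scale1r scale0r ?addr0 ?add0r. Qed.

Lemma lin_rot d (X Y : lmodType C) (F : X -> Y) g (e : bool * 'I_d -> X) p :
  lin F -> F (rot g e p) = rot g (F \o e) p.
Proof.
by move=> hF; rewrite (lin_sum hF); apply: eq_bigr => c _; rewrite (linZ hF).
Qed.

Lemma vmode_rot d (W : vertexAlgebra R) g (e : bool * 'I_d -> W) p n y :
  vmode (rot g e p) n y = \sum_(c : bool) g (idx c) (idx p.1) *: vmode (e (c, p.2)) n y.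
Proof. by rewrite vmode_suml; apply: eq_bigr => c _; rewrite vmodeZl. Qed.

Lemma vpar_rot d (W : vertexAlgebra R) g (e : bool * 'I_d -> W) p b :
  (forall q, vpar b (e q)) -> vpar b (rot g e p).
Proof.
move=> he; apply: (lin_closed_sum (@vpar_closed _ _ _)) => [|c _].
  exact: vpar0.
by apply: (lin_closedZ (@vpar_closed _ _ _)) => //; exact: vpar0.
Qed.

Section SymplecticFermions.
Variables (d : nat) (K : 'M[R]_d) (S : vertexAlgebra R) (etaS : bool * 'I_d -> S).
Hypothesis hS : symplectic_fermions K etaS.

Definition fermion_bracket (p q : bool * 'I_d) (n m : int) : C :=
  n%:~R * eps R p.1 q.1 * (invmx K p.2 q.2)%:C * (n + m == 0)%:R.

Lemma fermion_bracket_neg p q n m :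
  n < 0 -> m < 0 -> fermion_bracket p q n m = 0.
Proof.
by move=> hn hm; rewrite /fermion_bracket lt_eqF ?mulr0 // ltr_wnDr // ltW.
Qed.

(** The brackets depend on the sign indices through the symplectic form only,
    so that symplectic combinations of the generators satisfy the relations of
    the generators. *)
Lemma rot_bracket (W : vertexAlgebra R) (e : bool * 'I_d -> W) g p q n m x :
  sp2 g ->
  (forall p q y, vmode (e p) n (vmode (e q) m y) + vmode (e q) m (vmode (e p) n y)
     = fermion_bracket p q n m *: y) ->
  vmode (rot g e p) n (vmode (rot g e q) m x)
  + vmode (rot g e q) m (vmode (rot g e p) n x) = fermion_bracket p q n m *: x.
Proof.
move=> hg he; rewrite !vmode_rot.
have E a b r s y (u v : bool -> C) :
    \sum_(c : bool) u c *: vmode (e (c, a)) r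
      (\sum_(c' : bool) v c' *: vmode (e (c', b)) s y)
    = \sum_(c : bool) \sum_(c' : bool) (u c * v c') *:
        vmode (e (c, a)) r (vmode (e (c', b)) s y).
  apply: eq_bigr => c _; rewrite vmode_sumr scaler_sumr.
  by apply: eq_bigr => c' _; rewrite vmodeZr scalerA.
rewrite !E [X in _ + X]exchange_big -big_split /=.
under eq_bigr => c _ do rewrite -big_split /=.
rewrite [RHS](_ : _ = \sum_(c : bool) \sum_(c' : bool)
  (g (idx c) (idx p.1) * g (idx c') (idx q.1) *
   fermion_bracket (c, p.2) (c', q.2) n m) *: x).
  apply: eq_bigr => c _; apply: eq_bigr => c' _.
  by rewrite [X in _ + X *: _]mulrC -scalerDr he scalerA.
rewrite /fermion_bracket -(sp2_eps p.1 q.1 hg) /=.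
under [RHS]eq_bigr do rewrite -scaler_suml.
rewrite -scaler_suml; congr (_ *: _).
rewrite mulr_sumr !mulr_suml; apply: eq_bigr => c _.
rewrite mulr_sumr !mulr_suml; apply: eq_bigr => c' _.
by ring.
Qed.

Lemma fermion_rotation g : sp2 g -> exists F : S -> S,
  [/\ lin F, F (vac S) = vac S
    & forall p n x, F (vmode (etaS p) n x) = vmode (rot g etaS p) n (F x)].
Proof.
move=> hg; have [hfree hcom] := hS.
have hc p q n m x : vmode (etaS p) n (vmode (etaS q) m x)
   + vmode (etaS q) m (vmode (etaS p) n x) = fermion_bracket p q n m *: x.
  by case: p q => a A [b B]; apply: hcom.
apply: (free_fermion_universal hfree fermion_bracket_neg hc
  (e := fun p n => vmode (rot g etaS p) n)) => *.
- exact: vmode_lin.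
- by apply: rot_bracket => // *.
- by apply: mode_vac0.
Qed.

Variables (V W : vertexAlgebra R) (i : V -> W) (j : S -> W).
Hypothesis hW : va_tensor i j.
Variable eta : bool * 'I_d -> W.
Hypothesis heta : forall b, eta b = j (etaS b).

Let ihom : va_hom i. Proof. by case: hW. Qed.
Let jhom : va_hom j. Proof. by case: hW. Qed.
Let jlin : lin j. Proof. by case: jhom. Qed.

Lemma vac_tensor : vac W = i (vac V). Proof. by case: ihom. Qed.

Lemma vpar_eta p : vpar true (eta p).
Proof.
by rewrite heta; case: jhom => _ h _ _; apply: h; case: hS => -[].
Qed.

Lemma rot_eta g p : rot g eta p = j (rot g etaS p).
Proof. by rewrite (lin_rot _ _ _ jlin); apply: eq_bigr => c _ /=; rewrite heta. Qed.

Lemma vpar_rotS g p : vpar true (rot g etaS p).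
Proof. by apply: vpar_rot; case: hS => -[]. Qed.

(** The Koszul sign depends on the parity of [v]. Absorbing it into
    [v' = v0 - v1], where [v = v0 + v1] is the decomposition by parity, avoids
    splitting [v] whenever a letter is moved past it. *)
Lemma odd_cross v : exists v', forall s m n y, vpar true s ->
  vmode (j s) n (vmode (i v) m y) = vmode (i v') m (vmode (j s) n y) /\
  vmode (j s) n (vmode (i v') m y) = vmode (i v) m (vmode (j s) n y).
Proof.
have [v0 [v1 [h0 h1 ->]]] := vpar_dec v.
exists (v0 - v1) => s m n y hs; case: hW => -[hi _ _ _] _ hc _.
have c0 := hc _ _ _ _ m n y h0 hs; have c1 := hc _ _ _ _ m n y h1 hs.
rewrite /= expr0 scale1r in c0; rewrite /= expr1 scaleN1r in c1.
rewrite (linB hi) (linD hi) !vmodeDl !(linN (vmodel_lin _ _)) c0 c1 opprK.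
by rewrite !vmodeDr !vmodeNr.
Qed.

Lemma even_cross v s m n y : vpar false v ->
  vmode (i v) m (vmode (j s) n y) = vmode (j s) n (vmode (i v) m y).
Proof.
move=> hv; have [s0 [s1 [h0 h1 ->]]] := vpar_dec s.
case: hW => _ [hj _ _ _] hc _.
rewrite (linD hj) !vmodeDl vmodeDr (hc _ _ _ _ _ _ _ hv h0) (hc _ _ _ _ _ _ _ hv h1).
by rewrite !expr0 !scale1r.
Qed.

Lemma tens_vac v : tens i j v (vac S) = i v.
Proof. by rewrite /tens; case: jhom => _ _ -> _; rewrite mode_vac. Qed.

(** Pure tensors span [W], and the fermionic factor is spanned by words in the
    modes of its generators, which move past the matter factor. *)
Lemma complex_ind (P : W -> Prop) : lin_closed P -> (forall v, P (i v)) ->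
  (forall p n x, P x -> P (vmode (eta p) n x)) -> forall x, P x.
Proof.
move=> hP Pi Pe; apply: (tens_ind hW hP) => v s; move: s v.
apply: (free_ind (proj1 hS)) => [c s s' Ps Ps' v|v|p n s Ps v].
- by rewrite (tens_linr hW); apply: hP.
- by rewrite tens_vac.
have [v' hv'] := odd_cross v.
have hp : vpar true (etaS p) by case: hS => -[].
have := Pe p n _ (Ps v'); rewrite /tens heta.
rewrite (proj2 (hv' _ _ _ _ hp)); suff -> : vmode (j (etaS p)) n (j s) =
  j (vmode (etaS p) n s) by [].
by case: jhom => _ _ _ ->.
Qed.

Lemma complex_ext (X : lmodType C) (F G : W -> X)
    (e : bool * 'I_d -> int -> X -> X) : lin F -> lin G ->
  (forall v, F (i v) = G (i v)) ->
  (forall p n x, F (vmode (eta p) n x) = e p n (F x)) ->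
  (forall p n x, G (vmode (eta p) n x) = e p n (G x)) -> F =1 G.
Proof.
move=> hF hG hi heF heG; apply: complex_ind => // [c x y|p n x e0].
  by rewrite hF hG => -> ->.
by rewrite heF heG e0.
Qed.

Lemma eta_bracket p q n m x :
  vmode (eta p) n (vmode (eta q) m x) + vmode (eta q) m (vmode (eta p) n x)
  = fermion_bracket p q n m *: x.
Proof.
apply: (tens_ind hW (P := fun x => vmode (eta p) n (vmode (eta q) m x)
  + vmode (eta q) m (vmode (eta p) n x) = fermion_bracket p q n m *: x))
  => [c y z hy hz|v s].
  by rewrite !vmode_linr addrACA -scalerDr hy hz scalerDr !scalerA mulrC.
have [v' hv'] := odd_cross v; rewrite /tens !heta.
have ho q' : vpar true (etaS q') by case: hS => -[].
rewrite !(proj1 (hv' _ _ _ _ (ho _))) !(proj2 (hv' _ _ _ _ (ho _))).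
case: jhom => _ _ _ hj; rewrite -!hj -vmodeDr -(linD jlin).
case: hS => _ hc; case: p q => a A [b B]; rewrite hc.
by rewrite (linZ jlin) vmodeZr.
Qed.

(** These conditions determine [F], by [complex_ind]; that [F] is a homomorphism of
    vertex algebras is a consequence. *)
Definition is_rotation (g : 'M[C]_2) (F : W -> W) : Prop :=
  [/\ lin F, forall v, F (i v) = i v
    & forall p n x, F (vmode (eta p) n x) = vmode (rot g eta p) n (F x)].

Lemma rotation_exists g : sp2 g -> exists F, is_rotation g F.
Proof.
move=> hg; have [FS [Fl Fv Fe]] := fermion_rotation hg.
case: (hW) => _ _ _ univ.
have [] := univ W (fun v s => tens i j v (FS s)).
- by move=> c v v' s; apply: (tens_linl hW).
- by move=> c v s s'; rewrite Fl; apply: (tens_linr hW).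
move=> h [ht _].
have hl : lin h by move=> c x y; rewrite linearP.
exists h; split=> // [v|p n x]; first by rewrite -tens_vac ht Fv.
apply: (tens_ind hW (P := fun x =>
   h (vmode (eta p) n x) = vmode (rot g eta p) n (h x))) => [c y z hy hz|v s].
  by rewrite vmode_linr !hl hy hz vmode_linr.
have [v' hv'] := odd_cross v.
have hp : vpar true (etaS p) by case: hS => -[].
rewrite [h (tens _ _ _ _)]ht rot_eta /tens heta.
rewrite (proj1 (hv' _ _ _ _ hp)) (proj1 (hv' _ _ _ _ (vpar_rotS g p))).
by case: jhom => _ _ _ hj; rewrite -!hj ht Fe.
Qed.

Lemma rotation_unique g F G : is_rotation g F -> is_rotation g G -> F =1 G.
Proof.
move=> [Fl Fi Fe] [Gl Gi Ge].
by apply: (complex_ext (e := fun p n => vmode (rot g eta p) n)) => // v; rewrite Fi Gi.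
Qed.

Lemma rotation_comp g h F G :
  is_rotation g F -> is_rotation h G -> is_rotation (g *m h) (F \o G).
Proof.
move=> [Fl Fi Fe] [Gl Gi Ge]; split=> [|v|p n x] /=; first exact: lin_comp.
  by rewrite Gi Fi.
rewrite Ge !vmode_rot (lin_sum Fl).
rewrite -[RHS]vmode_rot rot_mul vmode_rot; apply: eq_bigr => c _.
by rewrite (linZ Fl) Fe.
Qed.

Lemma rotation_id : is_rotation 1%:M id.
Proof. by split=> // p n x; rewrite rot1. Qed.

Section Automorphism.
Variables (g : 'M[C]_2) (F : W -> W) (hF : is_rotation g F).

Let Fl : lin F. Proof. by case: hF. Qed.

Lemma rotation_matter_mode v m y : F (vmode (i v) m y) = vmode (i v) m (F y).
Proof.
case: hF => _ Fi Fe; move: y v.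
apply: complex_ind => [c x y hx hy v|v' v|p n x IH v].
- by rewrite vmode_linr !Fl hx hy vmode_linr.
- by case: ihom => _ _ _ hi; rewrite -hi !Fi hi.
have [v' hv'] := odd_cross v.
have hp : vpar true (etaS p) by case: hS => -[].
rewrite heta -(proj2 (hv' _ _ _ _ hp)) -heta !Fe IH rot_eta.
by rewrite (proj2 (hv' _ _ _ _ (vpar_rotS g p))).
Qed.

(** The iterate formula involves signs, so the induction along words has to keep
    track of parities. *)
Let good p x := vpar p (F x) /\ forall n y, F (vmode x n y) = vmode (F x) n (F y).

Lemma good_eta b p n x : vpar b x -> good b x -> good (~~ b) (vmode (eta p) n x).
Proof.
case: hF => _ _ Fe hx [Fx hm]; split.
  rewrite Fe -addTb; apply: vpar_mode => //.
  by apply: vpar_rot; apply: vpar_eta.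
move=> k y; rewrite Fe.
have hr : vpar true (rot g eta p) by apply: vpar_rot; apply: vpar_eta.
have [N1 h1] := vmode_iterate y n k (vpar_eta p) hx.
have [N2 h2] := vmode_iterate (F y) n k hr Fx.
rewrite (h1 (maxn N1 N2)) ?leq_maxl // (h2 (maxn N1 N2)) ?leq_maxr //.
rewrite (lin_sum Fl); apply: eq_bigr => r _.
by rewrite (linZ Fl) (linB Fl) (linZ Fl) Fe !hm Fe.
Qed.

Lemma rotation_good x : exists x0 x1,
  [/\ vpar false x0, vpar true x1, x = x0 + x1, good false x0 & good true x1].
Proof.
have glin b : lin_closed (good b).
  move=> c y z [vy hy] [vz hz]; split=> [|n w]; first by rewrite Fl; apply: vparD.
  by rewrite Fl !vmode_linl Fl hy hz.
move: x; apply: complex_ind => [c x y [x0 [x1 [p0 p1 -> g0 g1]]]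
    [y0 [y1 [q0 q1 -> h0 h1]]]|v|p n x [x0 [x1 [p0 p1 -> g0 g1]]]].
- exists (c *: x0 + y0), (c *: x1 + y1); split; try exact: vparD; try exact: glin.
  by rewrite scalerDr addrACA.
- have [v0 [v1 [h0 h1 ->]]] := vpar_dec v.
  case: hF ihom => _ Fi _ [hi hp _ _].
  have gi b w : vpar b w -> good b (i w).
    move=> hw; split; first by rewrite Fi; apply: hp.
    by move=> n y; rewrite rotation_matter_mode Fi.
  by exists (i v0), (i v1); split; rewrite ?(linD hi) //; auto.
exists (vmode (eta p) n x1), (vmode (eta p) n x0); split.
- by apply: (vpar_mode (p := true) (q := true)) => //; apply: vpar_eta.
- by apply: (vpar_mode (p := true) (q := false)) => //; apply: vpar_eta.
- by rewrite vmodeDr addrC.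
- exact: (good_eta p n p1 g1).
- exact: (good_eta p n p0 g0).
Qed.

(** Compatibility with the modes of generators implies compatibility with all
    modes, by the iterate formula. *)
Lemma rotation_hom : va_hom F.
Proof.
have Fm x n y : F (vmode x n y) = vmode (F x) n (F y).
  have [x0 [x1 [_ _ -> [_ m0] [_ m1]]]] := rotation_good x.
  by rewrite vmodeDl !(linD Fl) m0 m1 vmodeDl.
split=> // [p x hx|]; last by case: hF => _ Fi _; rewrite vac_tensor Fi.
have [x0 [x1 [h0 h1 ex [v0 _] [v1 _]]]] := rotation_good x.
have := hx; rewrite ex => /(vpar_split h0 h1).
by rewrite -ex => ->; case: (p).
Qed.

Lemma rotation_theta f (theta : 'I_d -> W -> W) A x :
  is_theta f eta theta i -> F (theta A x) = theta A (F x).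
Proof.
move=> /(_ A) [[tl _ tm] ti te]; case: hF => _ Fi Fe.
move: x; apply: complex_ind => [c x y|v|[a B] n x IH].
- by rewrite tl !Fl tl => -> ->.
- by rewrite Fi ti (lin0 Fl).
rewrite Fe !tm (linD Fl) !Fe IH; congr (_ + _).
rewrite te (linN (vmodel_lin _ _)) (linN Fl) vmode_suml (lin_sum Fl).
rewrite (lin_sum tl) vmode_suml.
under eq_bigr do rewrite vmodeZl (linZ Fl) Fe vmode_rot scaler_sumr /=.
rewrite exchange_big -sumrN /=; apply: eq_bigr => c _.
rewrite (linZ tl) vmodeZl te (linN (vmodel_lin _ _)) scalerN vmode_suml.
congr (- _); rewrite scaler_sumr; apply: eq_bigr => D _.
by rewrite vmodeZl !scalerA mulrC.
Qed.

End Automorphism.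
End SymplecticFermions.
End Rotations.

(** * Normally ordered products *)

Section NormalOrder.
Variables (R : realType).
Local Notation C := R[i].
Variable (W : vertexAlgebra R).
Implicit Types (l : seq (W * int)) (u v : W * int) (x y : W).

(** Normally ordered products of modes of arbitrary vectors: unlike words in the
    generators, they are linear in each letter. *)
Fixpoint nprod l x : W :=
  if l is (a, n) :: l' then
    if n < 0 then vmode a n (nprod l' x)
    else (- 1) ^+ size l' *: nprod l' (vmode a n x)
  else x.

Lemma nord_nprod d (e : bool * 'I_d -> W) (l : seq (bool * 'I_d * int)) x :
  nord e l x = nprod [seq (e q.1, q.2) | q <- l] x.
Proof. by elim: l x => //= -[p n] l IH x; rewrite /= size_map !IH. Qed.

Lemma nprod_lin l : lin (nprod l).
Proof.
elim: l => // -[a n] l IH c x y /=; case: ifP => _.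
  by rewrite IH vmode_linr.
by rewrite vmode_linr IH scalerDr !scalerA mulrC.
Qed.

Lemma nprod_letter_lin l1 l2 n x : lin (fun a => nprod (l1 ++ (a, n) :: l2) x).
Proof.
move=> c a b; elim: l1 x => [|[a' n'] l1 IH] x /=; case: ifP => _.
- by rewrite vmode_linl.
- by rewrite vmode_linl nprod_lin scalerDr !scalerA mulrC.
- by rewrite IH vmode_linr.
by rewrite !size_cat /= IH scalerDr !scalerA mulrC.
Qed.

Lemma nprod_swap l1 l2 u v x :
  (forall y, (u.2 < 0) = (v.2 < 0) ->
     vmode u.1 u.2 (vmode v.1 v.2 y) = - vmode v.1 v.2 (vmode u.1 u.2 y)) ->
  nprod (l1 ++ u :: v :: l2) x = - nprod (l1 ++ v :: u :: l2) x.
Proof.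
move=> huv; elim: l1 x => [|[a n] l1 IH] x /=; last first.
  case: ifP => _; first by rewrite IH vmodeNr.
  by rewrite IH scalerN !size_cat.
case: u v huv => a n [b m] /= huv.
case: ifP => hn; case: ifP => hm.
- by rewrite huv ?hn ?hm.
- by rewrite vmodeZr exprS mulN1r scaleNr opprK.
- by rewrite vmodeZr exprS mulN1r scaleNr.
rewrite huv ?hn ?hm // !(linN (nprod_lin _)) exprS mulN1r.
by rewrite !scaleNr !scalerN !opprK.
Qed.

Variable D : W -> W.
Hypothesis hD : even_derivation D.

Fixpoint nprod_derivs l : seq (seq (W * int)) :=
  if l is u :: l' then
    ((D u.1, u.2) :: l') :: [seq u :: l'' | l'' <- nprod_derivs l']
  else [::].

Lemma nprod_derivs_size l l' : l' \in nprod_derivs l -> size l' = size l.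
Proof.
elim: l l' => // u l IH l'; rewrite inE => /orP[/eqP-> //|/mapP[l'' h ->]].
by rewrite /= IH.
Qed.

Lemma nprod_derivation l x :
  D (nprod l x) = nprod l (D x) + \sum_(l' <- nprod_derivs l) nprod l' x.
Proof.
have [Dl _ Dm] := hD; elim: l x => [|[a n] l IH] x.
  by rewrite /= big_nil addr0.
rewrite /= big_cons big_map /=; case: ifP => hn.
  by rewrite Dm IH vmodeDr vmode_sumr addrCA.
rewrite (linZ Dl) IH Dm (linD (nprod_lin _)) !scalerDr scaler_sumr -addrA addrCA.
congr (_ + (_ + _)); rewrite big_seq [RHS]big_seq; apply: eq_bigr => l' hl'.
by rewrite (nprod_derivs_size hl').
Qed.

End NormalOrder.

(** * The differentials as doublets *)

(** The coefficients of the four independent cubic terms in a rotated [Q^-]; the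
    two cyclic relations have been used to eliminate the other two. *)
Lemma doublet_combination (R : realType) (X : lmodType R[i]) (p q r s : R[i])
    (A B1 B2 D : X) : p * s - q * r = 1 ->
  q *: (q *: (r *: - (B1 + B2)) + p *: (s *: B1 + r *: - (A + D)))
  + p *: (q *: (s *: B2 + r *: D) + p *: (s *: A)) = p *: A + q *: (B1 + B2).
Proof.
move=> h.
rewrite !(scalerDr, scalerN, scalerA, opprD) !addrA.
rewrite (ACl ((8*4)*((3*1)*(6*2))*(7*5))) /= -!scalerBl.
have -> : p * (p * s) - q * p * r = p by rewrite -[RHS]mulr1 -h; ring.
have -> : q * p * s - q * (q * r) = q by rewrite -[RHS]mulr1 -h; ring.
have -> : p * q * s - q * (q * r) = q by rewrite -[RHS]mulr1 -h; ring.
by rewrite (mulrC q p) subrr !scale0r addr0 addrA.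
Qed.

Section Differentials.
Variable R : realType.
Local Notation C := R[i].
Variables (d : nat) (f : 'I_d -> 'I_d -> 'I_d -> R) (K : 'M[R]_d).
Hypothesis (Ksym : K^T = K) (Kinv : invariant_form f K).
Variables (S : vertexAlgebra R) (etaS : bool * 'I_d -> S).
Hypothesis hS : symplectic_fermions K etaS.
Variables (V W : vertexAlgebra R) (i : V -> W) (j : S -> W).
Hypothesis hW : va_tensor i j.
Variable eta : bool * 'I_d -> W.
Hypothesis heta : forall b, eta b = j (etaS b).
Variables (JV : 'I_d -> V) (J : 'I_d -> W).
Hypothesis (hJV : forall A, vpar false (JV A)) (hJ : forall A, J A = i (JV A)).
Variable Lam : W -> W.
Hypothesis hLam : is_Lambda eta Lam i.

Local Notation D2 :=
  ([set p : int * int | [&& p.1 != 0, p.2 != 0 & p.1 != p.2]]).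
Local Notation D1 := ([set n : int | n != 0]).

Lemma flow_cyclic A B E : flow f K A B E = flow f K B E A.
Proof.
have br X Y : lie_br f (delta_mx 0 X) (delta_mx 0 Y) = \row_Z f X Y Z.
  apply/rowP => Z; rewrite /lie_br -rowE !mxE (bigD1 X) //= !mxE !eqxx mul1r.
  by rewrite big1 ?addr0 // => Y' /negPf ne; rewrite !mxE ne andbF mul0r.
have := Kinv (delta_mx 0 A) (delta_mx 0 B) (delta_mx 0 E); rewrite !br /bform.
rewrite trmx_delta -colE -rowE /flow !mxE => h.
transitivity (\sum_k (\row_Z f A B Z) 0 k * K k E).
  by apply: eq_bigr => k _; rewrite mxE.
rewrite h; apply: eq_bigr => k _; rewrite !mxE mulrC; congr (_ * _).
by rewrite -[in LHS]Ksym mxE.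
Qed.

Lemma eta_same_side p q (n m : int) y : (n < 0) = (m < 0) ->
  vmode (eta p) n (vmode (eta q) m y) = - vmode (eta q) m (vmode (eta p) n y).
Proof.
move=> h; apply/eqP; rewrite -subr_eq0 opprK (eta_bracket hS hW heta).
suff -> : fermion_bracket K p q n m = 0 by rewrite scale0r.
case: (ltP n 0) h => [hn /esym hm|hn /esym/negbT]; first exact: fermion_bracket_neg.
rewrite -leNgt /fermion_bracket => hm; case: eqP => [e|_]; last by rewrite mulr0.
have -> : n = 0 by lia.
by rewrite !mul0r.
Qed.

Lemma eta_J p A n m x :
  vmode (eta p) n (vmode (J A) m x) = vmode (J A) m (vmode (eta p) n x).
Proof. by rewrite hJ heta (even_cross hW). Qed.

Lemma modes_bounded x : exists N : nat, forall m : int, N%:Z <= m ->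
  (forall p, vmode (eta p) m x = 0) /\ (forall A, vmode (J A) m x = 0).
Proof.
have /choice[N1 h1] : forall p, exists N : int, forall n, N <= n -> vmode (eta p) n x = 0.
  by move=> p; apply: vmode_trunc.
have /choice[N2 h2] : forall A, exists N : int, forall n, N <= n -> vmode (J A) n x = 0.
  by move=> A; apply: vmode_trunc.
have [M1 hM1] : exists M : nat, forall p, (`|N1 p| <= M)%N.
  by exists (\max_p `|N1 p|)%N => p; apply: leq_bigmax.
have [M2 hM2] : exists M : nat, forall A, (`|N2 A| <= M)%N.
  by exists (\max_A `|N2 A|)%N => A; apply: leq_bigmax.
exists (M1 + M2)%N => m hm; split=> [p|A].
  by apply: h1; have := hM1 p; lia.
by apply: h2; have := hM2 A; lia.
Qed.

(** A mode of large index annihilates the vector even after other annihilation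
    modes have been applied, as these anticommute with it. *)
Lemma nord_bounded l x (N : nat) :
  (forall p (m : int), N%:Z <= m -> vmode (eta p) m x = 0) ->
  has (fun q => N%:Z <= q.2) l -> nord eta l x = 0.
Proof.
elim: l x => // -[p n] l IH x hx; rewrite [has _ _]/= => hl /=.
case: ifP => hn.
  rewrite IH ?vmode0r //; case/orP: hl => //; lia.
case: (boolP (N%:Z <= n)) hl => [hN _|_ /= hl].
  by rewrite hx // nord_nprod (lin0 (nprod_lin _)) scaler0.
rewrite IH ?scaler0 // => q m hm; rewrite eta_same_side; last by lia.
by rewrite hx ?vmode0r ?oppr0.
Qed.

Local Arguments nord : simpl never.
Local Arguments nprod : simpl never.

Definition int_range (M : nat) : seq int := [seq k%:Z - M%:Z | k <- iota 0 (M + M).+1].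

Lemma mem_int_range M (z : int) : (z \in int_range M) = (- M%:Z <= z <= M%:Z).
Proof.
apply/mapP/idP => [[k]|hz]; first by rewrite mem_iota => hk ->; lia.
by exists (absz (z + M%:Z)); rewrite ?mem_iota; lia.
Qed.

Definition current_term (c : bool) (x : W) (n : int) : W :=
  \sum_A (n%:~R)^-1 *: vmode (eta (c, A)) (- n) (vmode (J A) n x).

Definition current c x : W := \sum_(n \in D1) current_term c x n.

(** A weight [w] takes the place of [1 / (2 m n)], so that the cyclic symmetry
    can be applied before the weights are added up. *)
Definition cubic_weighted (w : C) a b c (x : W) (p : int * int) : W :=
  \sum_A \sum_B \sum_E (w * (flow f K A B E)%:C) *:
     nord eta [:: (a, A, - p.2); (b, B, p.1); (c, E, p.2 - p.1)] x.

Definition weight (p : int * int) : C := (2 * p.1%:~R * p.2%:~R)^-1.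

Definition cubic a b c x : W :=
  \sum_(p \in D2) cubic_weighted (weight p) a b c x p.

Lemma current_support x : exists r : seq int, forall c n,
  n \notin r -> current_term c x n = 0.
Proof.
have [N hN] := modes_bounded x; exists (int_range N) => c n.
rewrite mem_int_range => hn; rewrite /current_term big1 // => A _.
case: (lerP N%:Z n) => h; first by rewrite (proj2 (hN _ h)) vmode0r scaler0.
by rewrite eta_J (proj1 (hN _ _)) ?vmode0r ?scaler0 //; lia.
Qed.

Lemma cubic_support x : exists r : seq (int * int), forall w a b c p,
  p \notin r -> cubic_weighted w a b c x p = 0.
Proof.
have [N hN] := modes_bounded x.
exists [seq (m, n) | m <- int_range (N + N), n <- int_range (N + N)].
move=> w a b c [m n] hmn.
have {}hmn : ~~ ((m \in int_range (N + N)) && (n \in int_range (N + N))).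
  apply: contra hmn => /andP[h1 h2]; apply/allpairsP; by exists (m, n).
rewrite /cubic_weighted !big1 // => A _; rewrite big1 // => B _.
rewrite big1 // => E _; rewrite (@nord_bounded _ _ N) ?scaler0 //.
  by move=> p k hk; apply: (proj1 (hN _ hk)).
by move: hmn; rewrite !mem_int_range /=; lia.
Qed.

Lemma QminusE x : Qminus f K J eta x = current false x + cubic false false true x.
Proof.
rewrite /Qminus; congr (_ + _); apply: eq_fsbigr => p _.
apply: eq_bigr => A _; apply: eq_bigr => B _; apply: eq_bigr => E _.
by rewrite mulrC.
Qed.

Lemma current_lin c : lin (current c).
Proof.
move=> t x y; have [r hr] := current_support x; have [s hs] := current_support y.
rewrite /current -fsum_comb; try by [exists r => n _; apply: hr|exists s => n _; apply: hs].
apply: eq_fsbigr => n _; rewrite /current_term scaler_sumr -big_split.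
by apply: eq_bigr => A _; rewrite !vmode_linr scalerDr !scalerA mulrC.
Qed.

Lemma cubic_lin a b c : lin (cubic a b c).
Proof.
move=> t x y; have [r hr] := cubic_support x; have [s hs] := cubic_support y.
rewrite /cubic -fsum_comb; try by [exists r => p _; apply: hr|exists s => p _; apply: hs].
apply: eq_fsbigr => p _; rewrite /cubic_weighted scaler_sumr -big_split.
apply: eq_bigr => A _; rewrite scaler_sumr -big_split.
apply: eq_bigr => B _; rewrite scaler_sumr -big_split.
apply: eq_bigr => E _.
by rewrite !nord_nprod nprod_lin scalerDr !scalerA mulrC.
Qed.

Lemma Qminus_lin : lin (Qminus f K J eta).
Proof.
move=> t x y; rewrite !QminusE current_lin cubic_lin scalerDr.
by rewrite addrACA.
Qed.

Lemma nord_cyclic u v w x : nord eta [:: u; v; w] x = nord eta [:: v; w; u] x.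
Proof.
pose e (q : bool * 'I_d * int) := (eta q.1, q.2).
have sw l1 l2 q r : nprod (l1 ++ [:: e q, e r & l2]) x
    = - nprod (l1 ++ [:: e r, e q & l2]) x.
  by apply: nprod_swap => y; apply: eta_same_side.
rewrite !nord_nprod -[LHS]/(nprod ([::] ++ [:: e u; e v; e w]) x) sw.
by rewrite -[nprod _ _]/(nprod ([:: e v] ++ [:: e u; e w]) x) sw opprK.
Qed.

(** The cyclic permutation of the modes [(- n, m, n - m)] in terms of [(m, n)]. *)
Definition shift (p : int * int) : int * int := (p.2 - p.1, - p.1).

Lemma shift_bij : set_bij D2 D2 shift.
Proof.
split=> [[m n] /=|[m n] [m' n'] _ _ [] /= h1 h2|[m n] /= h].
- lia.
- by congr (_, _); lia.
exists (- n, m - n) => /=; first by lia.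
by rewrite /shift /=; congr (_, _); lia.
Qed.

Lemma cubic_weighted_cyclic w a b c x p :
  cubic_weighted w b c a x (shift p) = cubic_weighted w a b c x p.
Proof.
rewrite /cubic_weighted [RHS]exchange_big; apply: eq_bigr => B _.
rewrite [RHS]exchange_big; apply: eq_bigr => E _; apply: eq_bigr => A _.
rewrite -flow_cyclic; congr (_ *: _); rewrite [RHS]nord_cyclic.
have -> : - (shift p).2 = p.1 by rewrite opprK.
by have -> : (shift p).2 - (shift p).1 = - p.2 by rewrite /shift /=; lia.
Qed.

(** After cyclic relabelling the three sums differ only in their weights, which
    are proportional to [1 / (p1 p2)], [1 / (p2 p3)] and [1 / (p3 p1)] for
    [p1 = - n], [p2 = m], [p3 = n - m]; as [p1 + p2 + p3 = 0], the weights add up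
    to zero. *)
Lemma cubic_cyclic a b c x : cubic a b c x + cubic b c a x + cubic c a b x = 0.
Proof.
have sh u v w : cubic u v w x =
    \sum_(p \in D2) cubic_weighted (weight (shift p)) u v w x (shift p).
  by rewrite /cubic (reindex_fsbig _ _ _ _ shift_bij).
have -> : cubic c a b x = \sum_(p \in D2)
    cubic_weighted (weight (shift (shift p))) c a b x (shift (shift p)).
  by rewrite sh (reindex_fsbig _ _ _ _ shift_bij).
rewrite (sh b c a) /cubic.
under [X in _ + X + _]eq_fsbigr do rewrite cubic_weighted_cyclic.
under [X in _ + X]eq_fsbigr do rewrite !cubic_weighted_cyclic.
have [r hr] := cubic_support x.
rewrite !(@fsum_seq _ _ _ _ r) //; try by move=> *; apply: hr.
rewrite -!big_split big1 // => -[m n]; rewrite inE /= => /and3P[m0 n0 mn].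
rewrite /cubic_weighted -!big_split big1 // => A _.
rewrite -!big_split big1 // => B _; rewrite -!big_split big1 // => E _ /=.
rewrite -!scalerDl /weight /=.
suff -> : (2 * m%:~R * n%:~R)^-1 + (2 * (n - m)%:~R * (- m)%:~R)^-1
   + (2 * (- m - (n - m))%:~R * (- (n - m))%:~R)^-1 = 0 :> C.
  by rewrite !scale0r.
have m0' : m%:~R != 0 :> C by rewrite intr_eq0.
have n0' : n%:~R != 0 :> C by rewrite intr_eq0.
have mn' : n%:~R - m%:~R != 0 :> C by rewrite subr_eq0 eqr_int eq_sym.
rewrite !(rmorphB, rmorphN) /=.
have -> : - m%:~R - (n%:~R - m%:~R) = - n%:~R :> C by rewrite opprB addKr.
by field; rewrite m0' n0' mn'.
Qed.

Lemma cubic_diag a x : cubic a a a x = 0.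
Proof.
have := cubic_cyclic a a a x; rewrite -!mulr2n -mulrSr => /eqP.
by rewrite -scaler_nat scaler_eq0 pnatr_eq0 => /eqP.
Qed.

Lemma current_Lam x : Lam (current false x) = current false (Lam x) + current true x.
Proof.
have [[Ll Lp Lm] Li Lf Lt] := hLam.
have [r hr] := current_support x; have [s hs] := current_support (Lam x).
rewrite /current (fsum_lin Ll); last by exists r => n _; apply: hr.
rewrite -[X in X + _]scale1r -fsum_comb; first last.
- by exists r => n _; apply: hr.
- by exists s => n _; apply: hs.
apply: eq_fsbigr => n _; rewrite scale1r /current_term (lin_sum Ll) -big_split.
apply: eq_bigr => A _; rewrite (linZ Ll) !Lm hJ Li vmode0l add0r Lf scalerDr.
exact: addrC.
Qed.

Lemma cubic_Lam x : Lam (cubic false false true x)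
  = cubic false false true (Lam x) + (cubic true false true x + cubic false true true x).
Proof.
have [hd Li Lf Lt] := hLam; have [Ll Lp Lm] := hd.
have [r hr] := cubic_support x; have [s hs] := cubic_support (Lam x).
rewrite /cubic (fsum_lin Ll); last by exists r => n _; apply: hr.
rewrite !(@fsum_seq _ _ _ _ (r ++ s)); try by move=> p _; rewrite mem_cat negb_or =>
  /andP[hpr hps]; rewrite ?hr ?hs ?(lin0 Ll).
rewrite -!big_split; apply: eq_bigr => p _.
rewrite /cubic_weighted (lin_sum Ll) -!big_split; apply: eq_bigr => A _.
rewrite (lin_sum Ll) -!big_split; apply: eq_bigr => B _.
rewrite (lin_sum Ll) -!big_split; apply: eq_bigr => E _ /=.
rewrite (linZ Ll) -!scalerDr; congr (_ *: _).
rewrite !nord_nprod (nprod_derivation hd) /= !big_cons big_nil addr0 !Lf Lt.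
congr (_ + _); congr (_ + _); rewrite -[RHS]addr0; congr (_ + _).
by apply: (lin0 (@nprod_letter_lin _ _ [:: _; _] [::] _ _)).
Qed.

Lemma QplusE x : Qplus f K J eta Lam x
  = current true x + (cubic true false true x + cubic false true true x).
Proof.
have [[Ll _ _] _ _ _] := hLam.
rewrite /Qplus !QminusE (linD Ll) current_Lam cubic_Lam.
by rewrite addrACA [LHS]addrC addKr.
Qed.

Section Rotation.
Variables (g : 'M[C]_2) (F : W -> W).
Hypothesis (hg : sp2 g) (hF : is_rotation i eta g F).

Let Fl : lin F. Proof. by case: hF. Qed.

Lemma rotation_current c x :
  F (current c x) = \sum_(b : bool) g (idx b) (idx c) *: current b (F x).
Proof.
have [r hr] := current_support x; have [s hs] := current_support (F x).
rewrite /current (fsum_lin Fl); last by exists r => n _; apply: hr.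
rewrite -fsum_sum; last by move=> b; exists s => n _; apply: hs.
apply: eq_fsbigr => n _; rewrite /current_term (lin_sum Fl).
under [RHS]eq_bigr do rewrite scaler_sumr.
rewrite exchange_big; apply: eq_bigr => A _; case: hF => _ _ Fe.
rewrite (linZ Fl) Fe vmode_rot scaler_sumr; apply: eq_bigr => b _.
rewrite !scalerA mulrC; congr (_ *: vmode _ _ _).
by rewrite !hJ (rotation_matter_mode hS hW heta hF).
Qed.

Lemma rotation_nord l x : F (nord eta l x) = nord (rot g eta) l (F x).
Proof.
case: hF => _ _ Fe; elim: l x => // -[p n] l IH x; rewrite /nord /= -/nord.
case: ifP => _.
  by rewrite Fe IH.
by rewrite (linZ Fl) IH Fe.
Qed.

Lemma nord_rot3 p q r k m n y : nord (rot g eta) [:: (p, k); (q, m); (r, n)] y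
  = \sum_(a : bool) g (idx a) (idx p.1) *: \sum_(b : bool) g (idx b) (idx q.1) *:
    \sum_(c : bool) g (idx c) (idx r.1) *:
      nord eta [:: ((a, p.2), k); ((b, q.2), m); ((c, r.2), n)] y.
Proof.
have L l1 l2 u N z : nprod (l1 ++ (rot g eta u, N) :: l2) z =
   \sum_(a : bool) g (idx a) (idx u.1) *: nprod (l1 ++ (eta (a, u.2), N) :: l2) z.
  pose h a := nprod (l1 ++ (a, N) :: l2) z.
  have hl : lin h by apply: nprod_letter_lin.
  rewrite -[LHS]/(h _) /rot (lin_sum hl).
  by apply: eq_bigr => a _; rewrite (linZ hl).
rewrite nord_nprod (L [::]); apply: eq_bigr => a _; congr (_ *: _).
rewrite (L [:: _]); apply: eq_bigr => b _; congr (_ *: _).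
by rewrite (L [:: _; _]); apply: eq_bigr => c _; rewrite nord_nprod.
Qed.

Lemma rotation_cubic a b c x : F (cubic a b c x) =
  \sum_(a' : bool) g (idx a') (idx a) *: \sum_(b' : bool) g (idx b') (idx b) *:
  \sum_(c' : bool) g (idx c') (idx c) *: cubic a' b' c' (F x).
Proof.
have [r hr] := cubic_support x; have [s hs] := cubic_support (F x).
rewrite /cubic (fsum_lin Fl); last by exists r => n _; apply: hr.
under [RHS]eq_bigr => a' _ do under eq_bigr => b' _ do
  (rewrite -fsum_sum; last by move=> c'; exists s => p _; apply: hs).
under [RHS]eq_bigr => a' _ do (rewrite -fsum_sum; last by
  move=> b'; exists s => p _ hp; rewrite big1 // => t _; rewrite hs ?scaler0).
rewrite -fsum_sum; last first.
  move=> a'; exists s => p _ hp; rewrite big1 // => t _.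
  by rewrite big1 ?scaler0 // => t' _; rewrite hs ?scaler0.
apply: eq_fsbigr => p _; rewrite /cubic_weighted.
have push (X : finType) (u : bool -> C) (G : bool -> X -> W) :
    \sum_(t : bool) u t *: \sum_k G t k = \sum_k \sum_(t : bool) u t *: G t k.
  by rewrite exchange_big; apply: eq_bigr => t _; rewrite scaler_sumr.
have pushw (w : C) (u : bool -> C) (G : bool -> W) :
    \sum_(t : bool) u t *: (w *: G t) = w *: \sum_(t : bool) u t *: G t.
  by rewrite scaler_sumr; apply: eq_bigr => t _; rewrite !scalerA mulrC.
rewrite (lin_sum Fl).
under [RHS]eq_bigr => a' _ do under eq_bigr => b' _ do rewrite push.
under [RHS]eq_bigr => a' _ do rewrite push.
rewrite push; apply: eq_bigr => A _; rewrite (lin_sum Fl).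
under [RHS]eq_bigr => a' _ do under eq_bigr => b' _ do rewrite push.
under [RHS]eq_bigr => a' _ do rewrite push.
rewrite push; apply: eq_bigr => B _; rewrite (lin_sum Fl).
under [RHS]eq_bigr => a' _ do under eq_bigr => b' _ do rewrite push.
under [RHS]eq_bigr => a' _ do rewrite push.
rewrite push; apply: eq_bigr => E _; rewrite (linZ Fl) rotation_nord nord_rot3.
under [RHS]eq_bigr => a' _ do under eq_bigr => b' _ do rewrite pushw.
under [RHS]eq_bigr => a' _ do rewrite pushw.
by rewrite pushw.
Qed.

(** The current term is linear in the [eta]'s; the cubic term, having no spin 3/2
    part, transforms as a doublet times the determinant of [g], which is one. *)
Theorem rotation_Qminus x : F (Qminus f K J eta x)
  = g 0 0 *: Qminus f K J eta (F x) + g 1 0 *: Qplus f K J eta Lam (F x).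
Proof.
rewrite QminusE QplusE QminusE (linD Fl) rotation_current rotation_cubic.
move: (F x) => y; rewrite !big_bool /= !cubic_diag !scaler0 addr0 add0r.
set Tttf := cubic true true false y; set Ttft := cubic true false true y.
set Tftt := cubic false true true y; set Tfft := cubic false false true y.
set Tftf := cubic false true false y; set Ttff := cubic true false false y.
have e1 : Tttf = - (Ttft + Tftt).
  apply/eqP; rewrite -addr_eq0 addrA; apply/eqP; exact: cubic_cyclic.
have e2 : Ttff = - (Tfft + Tftf).
  apply/eqP; rewrite -addr_eq0 addrC; apply/eqP; exact: cubic_cyclic.
rewrite e1 e2 (doublet_combination _ _ _ _ (sp2_det hg)).
by rewrite [X in X + _]addrC addrACA !(scalerDr _ _ (Ttft + Tftt)) (scalerDr _ _ Tfft).
Qed.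

End Rotation.
End Differentials.

(** * Finiteness of orbits *)

(** Adjoin rows as long as the rank grows, which happens at most [m] times. *)
Lemma spanning_rows (F : fieldType) (T : Type) (Q : T -> Prop) (m : nat)
    (P : T -> 'rV[F]_m) : exists (k : nat) (t : 'I_k -> T),
  (forall r, Q (t r)) /\
  forall s, Q s -> (P s <= \matrix_(r < k) P (t r))%MS.
Proof.
suff H n : forall (k : nat) (t : 'I_k -> T), (forall r, Q (t r)) ->
    (m - \rank (\matrix_(r < k) P (t r)) <= n)%N ->
    exists (k : nat) (t : 'I_k -> T), (forall r, Q (t r)) /\
    forall s, Q s -> (P s <= \matrix_(r < k) P (t r))%MS.
  have t0 : 'I_0 -> T by case.
  by apply: (H m 0%N t0) => [[]//|]; apply: leq_subr.
elim: n => [|n IH] k t ht hr.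
  exists k, t; split=> // s _; apply: submx_full.
  by rewrite /row_full eqn_leq rank_leq_col -subn_eq0 -leqn0.
have [hs|] := pselect (forall s, Q s -> (P s <= \matrix_(r < k) P (t r))%MS).
  by exists k, t.
move=> /existsNP[s /not_implyP[Qs /negP sA]].
pose t' (r : 'I_k.+1) := if unlift ord0 r is Some r' then t r' else s.
apply: (IH k.+1 t') => [r|]; first by rewrite /t'; case: unliftP.
set A := (\matrix_(r < k) P (t r))%R in hr sA *.
set A' := \matrix_(r < k.+1) P (t' r).
have sA' : (P s <= A')%MS.
  have -> : P s = row ord0 A' by rewrite rowK /t' unlift_none.
  exact: row_sub.
have AA' : (A <= A')%MS.
  apply/row_subP => r; have -> : row r A = row (lift ord0 r) A'.
    by rewrite !rowK /t' liftK.
  exact: row_sub.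
have : (\rank A < \rank A')%N.
  rewrite ltn_neqAle mxrankS // andbT (mxrank_leqif_sup AA').
  by apply: contra sA; apply: submx_trans.
lia.
Qed.

Section Orbits.
Variable R : realType.
Local Notation C := R[i].
Local Notation M2 := 'M[C^o]_2.
Variables (d : nat) (K : 'M[R]_d) (S : vertexAlgebra R) (etaS : bool * 'I_d -> S).
Hypothesis hS : symplectic_fermions K etaS.
Variables (V W : vertexAlgebra R) (i : V -> W) (j : S -> W).
Hypothesis hW : va_tensor i j.
Variable eta : bool * 'I_d -> W.
Hypothesis heta : forall b, eta b = j (etaS b).

(** Along a generating word, the coefficients of an orbit are monomials in the
    matrix entries. *)
Lemma orbit_coefficients x : exists (T : finType) (p : T -> M2 -> C^o) (w : T -> W),
  (forall t, continuous (p t)) /\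
  forall g F, is_rotation i eta g F -> F x = \sum_t (p t g : C) *: w t.
Proof.
move: x; apply: (complex_ind hS hW heta).
- move=> c x y [T [p [w [hp hx]]]] [T' [p' [w' [hp' hy]]]].
  exists (T + T')%type,
    (fun t => match t with inl t => p t | inr t => p' t end),
    (fun t => match t with inl t => c *: w t | inr t => w' t end).
  split=> [[t|t]//|g F hF]; rewrite big_sumType /=.
  have [Fl _ _] := hF; rewrite Fl (hx _ _ hF) (hy _ _ hF) scaler_sumr.
  by congr (_ + _); apply: eq_bigr => t _; rewrite !scalerA mulrC.
- move=> v; exists unit, (fun _ _ => 1), (fun=> i v).
  split=> [t|g F [_ Fi _]]; first exact: cst_continuous.
  by rewrite Fi (bigD1 tt) //= scale1r big1 ?addr0 // => -[].
move=> q n x [T [p [w [hp hx]]]].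
exists (bool * T)%type, (fun t (g : M2) => g (idx t.1) (idx q.1) * p t.2 g),
  (fun t => vmode (eta (t.1, q.2)) n (w t.2)).
split=> [[b t] /= g|g F hF].
  by apply: continuousM; [exact: coord_continuous|exact: hp].
case: (hF) => Fl _ Fe; rewrite Fe vmode_rot (hx _ _ hF).
rewrite -(pair_bigA _ (fun b t => (g (idx b) (idx q.1) * p t g) *:
   vmode (eta (b, q.2)) n (w t))) /=.
apply: eq_bigr => b _; rewrite vmode_sumr scaler_sumr; apply: eq_bigr => t _.
by rewrite vmodeZr scalerA.
Qed.

(** The vectors [w] of [orbit_coefficients] need not be cocycles, so the orbit is
    re-expanded in points of its own: among the rows of coefficients [P h],
    finitely many span the others, and the coordinates of [P h] with respect to
    these depend linearly on [P h]. *)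
Lemma orbit_span (Q : M2 -> Prop) (Rot : M2 -> W -> W) x :
  (forall g, Q g -> is_rotation i eta g (Rot g)) ->
  exists (k : nat) (g : 'I_k -> M2) (c : 'I_k -> M2 -> C^o),
  [/\ forall r, Q (g r), forall r, continuous (c r)
    & forall h, Q h -> Rot h x = \sum_r (c r h : C) *: Rot (g r) x].
Proof.
move=> hRot; have [T [p [w [hp hx]]]] := orbit_coefficients x.
pose P (h : M2) : 'rV[C]_#|T| := \row_t (p (enum_val t) h : C).
have hsum h : Q h -> Rot h x = \sum_(t < #|T|) P h 0 t *: w (enum_val t).
  move=> Qh; rewrite (hx _ _ (hRot _ Qh)) (reindex (fun t => @enum_val T predT t)) /=.
    by apply: eq_bigr => t _; rewrite mxE.
  by exists enum_rank => t _; rewrite ?enum_valK ?enum_rankK.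
have [k [g [Qg hspan]]] := spanning_rows Q P.
set A := (\matrix_(r < k) P (g r))%R in hspan.
pose c (r : 'I_k) (h : M2) : C^o := (P h *m pinvmx A) 0 r.
exists k, g, c; split=> // [r|h Qh].
  have -> : c r = fun h => \sum_(t < #|T|) p (enum_val t) h * (pinvmx A t r : C^o).
    apply/funext => h; rewrite /c mxE; apply: eq_bigr => t _; by rewrite mxE.
  apply: continuous_big => [|t _ h]; first exact: add_continuous.
  by apply: continuousM; [exact: hp|exact: cst_continuous].
rewrite hsum // -(mulmxKpV (hspan _ Qh)).
under eq_bigr do rewrite mxE scaler_suml.
rewrite exchange_big; apply: eq_bigr => r _; rewrite hsum // scaler_sumr.
by apply: eq_bigr => t _; rewrite -scalerA [A r t]mxE.
Qed.

End Orbits.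

(** * Cohomology *)

Section SymplecticGroup.
Variable R : realType.
Local Notation C := R[i].

Definition mx2 (a b c e : C) : 'M[C]_2 := \matrix_(k, l)
  if k == 0 then (if l == 0 then a else b) else (if l == 0 then c else e).

Lemma mx2E (a b c e : C) : (mx2 a b c e 0 0 = a) * (mx2 a b c e 0 1 = b) *
  (mx2 a b c e 1 0 = c) * (mx2 a b c e 1 1 = e).
Proof. by rewrite !mxE. Qed.

Lemma matrix2P (g h : 'M[C]_2) : g 0 0 = h 0 0 -> g 0 1 = h 0 1 ->
  g 1 0 = h 1 0 -> g 1 1 = h 1 1 -> g = h.
Proof.
have I2 (k : 'I_2) : k = 0 \/ k = 1.
  by case: k => -[|[|//]] hk; [left|right]; apply: val_inj.
by move=> *; apply/matrixP => k l; case: (I2 k) (I2 l) => -> [] ->.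
Qed.

Lemma mulmx2E (g h : 'M[C]_2) k l : (g *m h) k l = g k 0 * h 0 l + g k 1 * h 1 l.
Proof.
rewrite mxE big_ord_recl big_ord1; congr (_ + g k _ * h _ l); exact: val_inj.
Qed.

Lemma det_sp2 (g : 'M[C]_2) : g 0 0 * g 1 1 - g 1 0 * g 0 1 = 1 -> sp2 g.
Proof.
move=> h; rewrite /sp2; apply: matrix2P; rewrite !mulmx2E !mxE /=.
- by ring.
- by rewrite -[in RHS]h; ring.
- by rewrite -[in RHS]h; ring.
- by ring.
Qed.

Lemma sp2_1 : sp2 (1%:M : 'M[C]_2).
Proof. by rewrite /sp2 trmx1 mul1mx mulmx1. Qed.

Lemma sp2_mul (g h : 'M[C]_2) : sp2 g -> sp2 h -> sp2 (g *m h).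
Proof.
by rewrite /sp2 => hg hh; rewrite trmx_mul !mulmxA -(mulmxA h^T) -(mulmxA h^T) hg.
Qed.

Definition adj2 (g : 'M[C]_2) := mx2 (g 1 1) (- g 0 1) (- g 1 0) (g 0 0).

Lemma sp2_adj (g : 'M[C]_2) : sp2 g -> sp2 (adj2 g).
Proof.
move=> /sp2_det h; apply: det_sp2; by rewrite !mx2E -[in RHS]h; ring.
Qed.

Lemma mul_adj2 (g : 'M[C]_2) : sp2 g -> g *m adj2 g = 1%:M.
Proof.
move=> /sp2_det h; apply: matrix2P; rewrite !mulmx2E !mx2E !mxE /= ?mulr1n ?mulr0n;
  rewrite -?[in RHS]h; ring.
Qed.

Lemma mul_adj2_left (g : 'M[C]_2) : sp2 g -> adj2 g *m g = 1%:M.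
Proof.
move=> /sp2_det h; apply: matrix2P; rewrite !mulmx2E !mx2E !mxE /= ?mulr1n ?mulr0n;
  rewrite -?[in RHS]h; ring.
Qed.

(** Rotation by [weyl2] turns [Q^-] into [Q^+], rotation by [shear2] turns it into
    [Q^- + Q^+]. *)
Definition weyl2 := mx2 0 (- 1) 1 0.
Definition shear2 := mx2 1 0 1 1.

Lemma sp2_weyl : sp2 weyl2.
Proof. by apply: det_sp2; rewrite !mx2E; ring. Qed.

Lemma sp2_shear : sp2 shear2.
Proof. by apply: det_sp2; rewrite !mx2E; ring. Qed.

Lemma torus2E (t : C) : torus2 t = mx2 t 0 0 t^-1.
Proof. by apply: matrix2P; rewrite !mxE. Qed.

Lemma sp2_torus (t : C) : t != 0 -> sp2 (torus2 t).
Proof. by move=> t0; rewrite torus2E; apply: det_sp2; rewrite !mx2E mulr0 subr0 divff. Qed.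

Lemma usp2_sp2 (g : 'M[C]_2) : usp2 g -> sp2 g.
Proof. by case. Qed.

End SymplecticGroup.

Section Cohomology.
Variable R : realType.
Local Notation C := R[i].
Variables (d : nat) (f : 'I_d -> 'I_d -> 'I_d -> R) (K : 'M[R]_d).
Hypothesis (Ksym : K^T = K) (Kinv : invariant_form f K).
Variables (S : vertexAlgebra R) (etaS : bool * 'I_d -> S).
Hypothesis hS : symplectic_fermions K etaS.
Variables (V W : vertexAlgebra R) (i : V -> W) (j : S -> W).
Hypothesis hW : va_tensor i j.
Variable eta : bool * 'I_d -> W.
Hypothesis heta : forall b, eta b = j (etaS b).
Variables (JV : 'I_d -> V) (J : 'I_d -> W).
Hypothesis (hJV : forall A, vpar false (JV A)) (hJ : forall A, J A = i (JV A)).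
Variable Lam : W -> W.
Hypothesis hLam : is_Lambda eta Lam i.
Variable theta : 'I_d -> W -> W.
Hypothesis htheta : is_theta f eta theta i.
Hypothesis hQQ : QQ_lemma f K J eta theta Lam.
Variables (H : vertexAlgebra R) (pi : W -> H).
Hypothesis hH : relative_cohomology f K J eta theta pi.

Local Notation Qm := (Qminus f K J eta).
Local Notation Qp := (Qplus f K J eta Lam).
Local Notation rel := (relC J theta).
Local Notation Z := (cocycle f K J eta theta).
Local Notation B := (coboundary f K J eta theta).

Lemma Qm_lin : lin Qm.
Proof. exact: (Qminus_lin f hS hW heta hJV hJ). Qed.

Lemma Qp_lin : lin Qp.
Proof.
have [[Ll _ _] _ _ _] := hLam => c x y.
rewrite /Qplus Ll !Qm_lin Ll opprD addrACA; congr (_ + _).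
by rewrite scalerBr.
Qed.

Lemma J_even A : vpar false (J A).
Proof. by rewrite hJ; case: hW => -[_ h _ _] _ _ _; apply: h. Qed.

Lemma rel_lin : lin_closed rel.
Proof.
move=> c x y hx hy A; have [[tl _ _] _ _] := htheta A.
by rewrite vmode_linr tl addrACA -scalerDr hx hy scaler0 addr0.
Qed.

Lemma rel0 : rel 0.
Proof.
by move=> A; have [[tl _ _] _ _] := htheta A; rewrite vmode0r (lin0 tl) addr0.
Qed.

Definition relZ := lin_closedZ rel_lin rel0.
Definition relD := lin_closedD rel_lin.

(** Vanishing of the square of the differential comes with the existence of the
    cohomology: coboundaries are cocycles. *)
Lemma Qm_rel y : rel y -> rel (Qm y) /\ Qm (Qm y) = 0.
Proof.
move=> hy; have [_ [_ [_ hB]]] := hH.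
by have /hB[] : B (Qm y) by exists y.
Qed.

Lemma pi_coboundary x : B x -> pi x = 0.
Proof. by have [_ [_ [_ hB]]] := hH; move=> /hB[]. Qed.

Lemma pi_lin c x y : Z x -> Z y -> pi (c *: x + y) = c *: pi x + pi y.
Proof. by have [_ [[h _ _ _] _]] := hH; apply: h. Qed.

Lemma Z_lin : lin_closed Z.
Proof. by have [[h _ _] _] := hH => c x y hx hy; apply: h. Qed.

Lemma Z0 : Z 0.
Proof. by split; [exact: rel0|exact: (lin0 Qm_lin)]. Qed.

Lemma Z_coboundary x : B x -> Z x.
Proof. by case=> y hy ->; apply: Qm_rel. Qed.

Lemma pi0 : pi 0 = 0.
Proof.
by apply: pi_coboundary; exists 0; [exact: rel0|rewrite (lin0 Qm_lin)].
Qed.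

Lemma piZ c x : Z x -> pi (c *: x) = c *: pi x.
Proof.
by move=> hx; rewrite -[c *: x]addr0 pi_lin //; [rewrite pi0 addr0|exact: Z0].
Qed.

Lemma pi_add_coboundary x b : Z x -> B b -> pi (x + b) = pi x.
Proof.
move=> hx hb; rewrite -[x]scale1r pi_lin //; last exact: Z_coboundary.
by rewrite (pi_coboundary hb) addr0 !scale1r.
Qed.

Section Family.
Variable Rot : 'M[C]_2 -> W -> W.
Hypothesis hRot : forall g, sp2 g -> is_rotation i eta g (Rot g).

Lemma Rot_lin g : sp2 g -> lin (Rot g).
Proof. by case/hRot. Qed.

Lemma Rot_mul g h x : sp2 g -> sp2 h -> Rot (g *m h) x = Rot g (Rot h x).
Proof.
move=> hg hh; have hgh := rotation_comp (hRot hg) (hRot hh).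
exact: (rotation_unique hS hW heta (hRot (sp2_mul hg hh)) hgh).
Qed.

Lemma Rot_1 x : Rot 1%:M x = x.
Proof.
exact: (rotation_unique hS hW heta (hRot (sp2_1 R)) (rotation_id _ _)).
Qed.

Lemma RotK g x : sp2 g -> Rot (adj2 g) (Rot g x) = x.
Proof.
by move=> hg; rewrite -Rot_mul ?mul_adj2_left ?Rot_1 //; apply: sp2_adj.
Qed.

Lemma RotVK g x : sp2 g -> Rot g (Rot (adj2 g) x) = x.
Proof.
by move=> hg; rewrite -Rot_mul ?mul_adj2 ?Rot_1 //; apply: sp2_adj.
Qed.

Lemma Rot_Qm g x : sp2 g ->
  Rot g (Qm x) = g 0 0 *: Qm (Rot g x) + g 1 0 *: Qp (Rot g x).
Proof.
by move=> hg; apply: (rotation_Qminus Ksym Kinv hS hW heta hJV hJ hLam hg (hRot hg)).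
Qed.

Lemma Qp_weyl x : Qp x = Rot (weyl2 R) (Qm (Rot (adj2 (weyl2 R)) x)).
Proof.
have hw := sp2_weyl R.
by rewrite Rot_Qm // RotVK // !mx2E scale0r scale1r add0r.
Qed.

Lemma Rot_Qp g x : sp2 g ->
  Rot g (Qp x) = g 0 1 *: Qm (Rot g x) + g 1 1 *: Qp (Rot g x).
Proof.
move=> hg; have hw := sp2_weyl R; rewrite Qp_weyl -Rot_mul // Rot_Qm; last exact: sp2_mul.
rewrite Rot_mul // RotVK // !mulmx2E !mx2E.
by rewrite !mulr0 !mulr1 !add0r.
Qed.

Lemma Rot_rel g x : sp2 g -> rel x -> rel (Rot g x).
Proof.
move=> hg hx A; rewrite hJ.
rewrite -(rotation_matter_mode hS hW heta (hRot hg)) -hJ.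
rewrite -(rotation_theta hS hW heta (hRot hg) _ _ htheta).
by rewrite -(linD (Rot_lin hg)) hx (lin0 (Rot_lin hg)).
Qed.

Lemma Qp_rel y : rel y -> rel (Qp y) /\ Qp (Qp y) = 0.
Proof.
move=> hy; have hw := sp2_weyl R; have hw' := sp2_adj hw.
have [h1 h2] := Qm_rel (Rot_rel hw' hy).
rewrite (Qp_weyl y); split; first exact: Rot_rel.
by rewrite Qp_weyl RotK // h2 (lin0 (Rot_lin hw)).
Qed.

(** The cross terms in the square of [Q^- + Q^+], which is a rotated [Q^-]. *)
Lemma QmQp_anti y : rel y -> Qm (Qp y) = - Qp (Qm y).
Proof.
move=> hy; have hs := sp2_shear R; have hs' := sp2_adj hs.
have E x : Qm x + Qp x = Rot (shear2 R) (Qm (Rot (adj2 (shear2 R)) x)).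
  by rewrite Rot_Qm // RotVK // !mx2E !scale1r.
have [_ h2] := Qm_rel (Rot_rel hs' hy).
have : Qm (Qm y + Qp y) + Qp (Qm y + Qp y) = 0.
  by rewrite !E RotK // h2 (lin0 (Rot_lin hs)).
rewrite (linD Qm_lin) (linD Qp_lin) (proj2 (Qm_rel hy)) (proj2 (Qp_rel hy)).
by rewrite add0r addr0 => /eqP; rewrite addr_eq0 => /eqP.
Qed.

(** Rotations mix the two differentials, so they act on the vectors that both
    annihilate, not on all cocycles. *)
Definition bicocycle x := Z x /\ Qp x = 0.

Lemma bicocycle_Rot g x : sp2 g -> bicocycle x -> bicocycle (Rot g x).
Proof.
have main h y : sp2 h -> bicocycle y -> Qm (Rot h y) = 0.
  move=> hh [[_ y0] y1]; have hh' := sp2_adj hh.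
  rewrite -[Qm _](RotVK _ hh) (Rot_Qm _ hh') RotK // y0 y1.
  by rewrite !scaler0 addr0 (lin0 (Rot_lin hh)).
move=> hg hx; have hw := sp2_weyl R; have hw' := sp2_adj hw.
split; first by split; [apply: Rot_rel => //; case: hx => -[]|exact: main].
rewrite Qp_weyl -Rot_mul // (main _ _ (sp2_mul hw' hg) hx).
exact: (lin0 (Rot_lin hw)).
Qed.

(** Closedness under [Q^+] becomes closedness of a rotated vector under [Q^-]; in
    this way bicocycles inherit from cocycles that they form a vertex
    subalgebra. *)
Lemma bicocycleP x : bicocycle x <-> Z x /\ Z (Rot (adj2 (weyl2 R)) x).
Proof.
have hw := sp2_weyl R; have hw' := sp2_adj hw.
split=> [hx|[hx [_ h0]]].
  by split; [case: hx|case: (bicocycle_Rot hw' hx)].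
by split=> //; rewrite Qp_weyl h0 (lin0 (Rot_lin hw)).
Qed.

Lemma bicocycle_lin : lin_closed bicocycle.
Proof.
move=> c x y [hx ex] [hy ey]; split; first exact: Z_lin.
by rewrite Qp_lin ex ey scaler0 addr0.
Qed.

Lemma bicocycle_vac : bicocycle (vac W).
Proof.
have [[_ hv _] _] := hH; apply/bicocycleP; split=> //.
have [_ _ -> _] // := rotation_hom hS hW heta (hRot (sp2_adj (sp2_weyl R))).
Qed.

Lemma bicocycle_mode x n y : bicocycle x -> bicocycle y -> bicocycle (vmode x n y).
Proof.
have [[_ _ hm] _] := hH.
move=> /bicocycleP[hx hx'] /bicocycleP[hy hy']; apply/bicocycleP; split.
  exact: hm.
have [_ _ _ ->] := rotation_hom hS hW heta (hRot (sp2_adj (sp2_weyl R))).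
exact: hm.
Qed.

(** A bicocycle that is exact has the form [Q^- Q^+ y], and [Q^- Q^+] commutes with
    rotations, as they have determinant one. *)
Lemma exact_Rot g x : sp2 g -> bicocycle x -> B x -> B (Rot g x).
Proof.
move=> hg [[hx x0] x1] [x' hx' ex].
have [y hy ->] := hQQ hx x0 x1 (or_introl (ex_intro2 _ _ x' hx' ex)).
have ht := Rot_rel hg hy; move: (Rot g y) (Rot_Qp y hg) ht => t et ht.
have [h1 h2] := Qm_rel ht; have [h3 h4] := Qp_rel ht.
exists (Qp t) => //.
rewrite Rot_Qm // et Qm_lin Qp_lin (linZ Qm_lin) (linZ Qp_lin) h2 h4.
rewrite -[Qp (Qm t)]opprK -(QmQp_anti ht) !scaler0 add0r addr0 !scalerA scalerN.
by rewrite -scalerBl (sp2_det hg) scale1r.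
Qed.

(** The [Q^- Q^+] lemma is applied to [Q^+ x], which is closed for both
    differentials. *)
Lemma bicocycle_rep x : Z x -> exists y, rel y /\ bicocycle (x + Qm y).
Proof.
move=> [hx x0]; have [h3 h4] := Qp_rel hx.
have a0 : Qm (Qp x) = 0 by rewrite QmQp_anti // x0 (lin0 Qp_lin) oppr0.
have [y hy ey] := hQQ h3 a0 h4 (or_intror (ex_intro2 _ _ x hx erefl)).
have [h1 h2] := Qm_rel hy.
exists y; split=> //; split.
  by split; [exact: relD|rewrite (linD Qm_lin) x0 h2 addr0].
by rewrite (linD Qp_lin) ey QmQp_anti // addNr.
Qed.

Lemma pi_Rot_eq g x y : sp2 g -> bicocycle x -> bicocycle y -> pi x = pi y ->
  pi (Rot g x) = pi (Rot g y).
Proof.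
move=> hg hx hy e.
have hxy : bicocycle (x - y).
  rewrite -scaleN1r addrC; exact: bicocycle_lin.
have [_ [_ [_ hB]]] := hH.
have /(exact_Rot hg hxy)/pi_coboundary : B (x - y).
  apply/hB; split; first by case: hxy.
  rewrite -scaleN1r addrC pi_lin ?e; [|by case: hy|by case: hx].
  by rewrite scaleN1r addNr.
rewrite -scaleN1r addrC (Rot_lin hg) pi_lin; first last.
- by case: (bicocycle_Rot hg hx).
- by case: (bicocycle_Rot hg hy).
by rewrite scaleN1r addrC => /eqP; rewrite subr_eq0 => /eqP.
Qed.

Lemma nord_parity l p x : vpar p x -> vpar (p (+) odd (size l)) (nord eta l x).
Proof.
elim: l p x => [|[q n] l IH] p x hx /=; first by rewrite addbF.
have hq y b : vpar b y -> vpar (~~ b) (vmode (eta q) n y).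
  by move=> hy; rewrite -addTb; apply: vpar_mode => //; apply: (vpar_eta hS hW heta).
case: ifP => _; first by rewrite addbN; apply: hq; apply: IH.
apply: (lin_closedZ (@vpar_closed _ _ _)); first exact: vpar0.
by rewrite addbN -addNb; apply: IH; apply: hq.
Qed.

Lemma Qm_odd p x : vpar p x -> vpar (~~ p) (Qm x).
Proof.
move=> hx.
have cl := @vpar_closed R W (~~ p); have c0 := @vpar0 R W (~~ p).
rewrite /Qminus; apply: (lin_closedD cl).
  apply: (lin_closed_sum cl c0) => n _; apply: (lin_closed_sum cl c0) => A _.
  apply: (lin_closedZ cl c0); rewrite -addTb.
  apply: vpar_mode; first exact: (vpar_eta hS hW heta).
  by rewrite -[p]addFb; apply: vpar_mode => //; apply: J_even.
apply: (lin_closed_sum cl c0) => q _; do 3 apply: (lin_closed_sum cl c0) => ? _.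
apply: (lin_closedZ cl c0); rewrite -addbT.
exact: (@nord_parity [:: _; _; _]).
Qed.

Lemma Z_parity x0 x1 : vpar false x0 -> vpar true x1 -> Z (x0 + x1) ->
  Z x0 /\ Z x1.
Proof.
move=> h0 h1 [hr hq].
have split0 (u v : W) : vpar false u -> vpar true v -> u + v = 0 -> u = 0 /\ v = 0.
  move=> hu hv e; have hu' : vpar false (u + v) by rewrite e; apply: vpar0.
  by have := vpar_split hu hv hu'; rewrite e => e'; move: e; rewrite -e' add0r.
rewrite (linD Qm_lin) addrC in hq.
have [q1 q0] := split0 _ _ (Qm_odd h1) (Qm_odd h0) hq.
have hr' A : (vmode (J A) 0 x0 + theta A x0 = 0) /\ (vmode (J A) 0 x1 + theta A x1 = 0).
  have [[tl tp _] _ _] := htheta A.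
  have par p x : vpar p x -> vpar p (vmode (J A) 0 x + theta A x).
    move=> hx; apply: (lin_closedD (@vpar_closed _ _ _)); last exact: tp.
    by rewrite -[p]addFb; apply: vpar_mode => //; apply: J_even.
  apply: split0; [exact: par|exact: par|].
  by rewrite addrACA -vmodeDr -(linD tl); apply: hr.
by split; split=> // A; case: (hr' A).
Qed.

(** [Q^-] and rotations are compatible with parity, so the components of a
    bicocycle are bicocycles; the component of the wrong parity is exact. *)
Lemma bicocycle_parity p x : bicocycle x -> vpar p (pi x) ->
  exists2 y, bicocycle y & vpar p y /\ pi y = pi x.
Proof.
move=> hx hp; have [x0 [x1 [h0 h1 ex]]] := vpar_dec x.
have hw := sp2_adj (sp2_weyl R).
have [_ [[_ pip _ _] _]] := hH.
have [z0 z1] : Z x0 /\ Z x1 by apply: Z_parity => //; rewrite -ex; case: hx.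
have [Rl Rp _ _] := rotation_hom hS hW heta (hRot hw).
have [w0 w1] : Z (Rot (adj2 (weyl2 R)) x0) /\ Z (Rot (adj2 (weyl2 R)) x1).
  apply: Z_parity; [exact: Rp|exact: Rp|].
  by rewrite -(linD (Rot_lin hw)) -ex; case: (bicocycle_Rot hw hx).
have b0 : bicocycle x0 by apply/bicocycleP.
have b1 : bicocycle x1 by apply/bicocycleP.
have epi : pi x = pi x0 + pi x1 by rewrite ex -[pi x0]scale1r -pi_lin // scale1r.
rewrite epi in hp *.
have e := vpar_split (pip _ _ z0 h0) (pip _ _ z1 h1) hp; rewrite e.
by case: p {hp} e => _; [exists x1|exists x0].
Qed.

Lemma Rot_torus t k x : t != 0 -> eta_degree eta i k x ->
  Rot (torus2 t) x = t ^ k *: x.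
Proof.
move=> t0; have [Fl Fi Fe] := hRot (sp2_torus t0).
have rE b A : rot (torus2 t) eta (b, A) = (if b then t^-1 else t) *: eta (b, A).
  by rewrite /rot big_bool torus2E; case: b; rewrite /= !mx2E scale0r ?addr0 ?add0r.
elim=> [v|k' A n y _ IH|k' A n y _ IH|k' c y z _ IHy _ IHz].
- by rewrite Fi expr0z scale1r.
- by rewrite Fe rE IH vmodeZl vmodeZr scalerA mulrC expfzDr // expr1z.
- by rewrite Fe rE IH vmodeZl vmodeZr scalerA mulrC expfzDr.
by rewrite Fl IHy IHz scalerDr !scalerA mulrC.
Qed.

(** The action: rotate a representative that is closed for both differentials. *)
Theorem usp2_action_exists : exists rho : 'M[C]_2 -> H -> H,
  usp2_action rho /\
  (forall (t : C) (k : int) (h : H), `|t| = 1 ->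
     cohomology_degree f K J eta theta i pi k h ->
     rho (torus2 t) h = t ^ k *: h).
Proof.
have [[_ _ _] [[_ pip piv pim] [pis _]]] := hH.
have /choice[sec hsec] : forall h, exists x, bicocycle x /\ pi x = h.
  move=> h; have [x hx <-] := pis h; have [y [hy hxy]] := bicocycle_rep hx.
  exists (x + Qm y); split=> //.
  by apply: pi_add_coboundary => //; exists y.
pose rho g h := pi (Rot g (sec h)).
have rhoE g x : sp2 g -> bicocycle x -> rho g (pi x) = pi (Rot g x).
  by move=> hg hx; apply: pi_Rot_eq => //; case: (hsec (pi x)).
have rho1 h : rho 1%:M h = h by rewrite /rho Rot_1; case: (hsec h).
have bZ x : bicocycle x -> Z x by case.
have rhoM g g' h : sp2 g -> sp2 g' -> rho (g *m g') h = rho g (rho g' h).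
  move=> hg hg'; have [hx <-] := hsec h; have hgg := sp2_mul hg hg'.
  rewrite !rhoE //; last exact: bicocycle_Rot.
  by rewrite Rot_mul.
exists rho; split.
  split=> //.
  - move=> g /usp2_sp2 hg; split; last first.
      have hg' := sp2_adj hg; exists (rho (adj2 g)) => h.
        by rewrite -rhoM // mul_adj2_left // rho1.
      by rewrite -rhoM // mul_adj2 // rho1.
    have [Rl Rp Rv Rm] := rotation_hom hS hW heta (hRot hg).
    split.
    + move=> c h h'; have [hx <-] := hsec h; have [hx' <-] := hsec h'.
      rewrite -pi_lin ?rhoE //; try by [exact: bZ|exact: bicocycle_lin].
      by rewrite Rl pi_lin //; apply/bZ/bicocycle_Rot.
    + move=> p h hp; have [hx e] := hsec h.
      have [y hy [py ey]] : exists2 y, bicocycle y & vpar p y /\ pi y = pi (sec h).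
        by apply: bicocycle_parity => //; rewrite e.
      rewrite -e -ey rhoE //; apply: pip; last exact: Rp.
      exact/bZ/bicocycle_Rot.
    + by rewrite -piv rhoE //; [rewrite Rv|exact: bicocycle_vac].
    + move=> h n h'; have [hx <-] := hsec h; have [hx' <-] := hsec h'.
      rewrite -pim ?rhoE //; try by [exact: bZ|exact: bicocycle_mode].
      by rewrite Rm pim //; apply/bZ/bicocycle_Rot.
  - by move=> g g' h /usp2_sp2 hg /usp2_sp2 hg'; apply: rhoM.
  move=> h; have [hx e] := hsec h.
  have [k [g [c [Qg cc hspan]]]] :=
    @orbit_span R d K S etaS hS V W i j hW eta heta (@usp2 R) Rot (sec h)
      (fun g hg => hRot (usp2_sp2 hg)).
  exists k, (fun r => pi (Rot (g r) (sec h))), c; split=> [r|g' hg'].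
    by apply: continuous_subspaceT; apply: cc.
  rewrite /rho hspan //.
  suff [_ ->] : Z (\sum_r (c r g' : C) *: Rot (g r) (sec h)) /\
     pi (\sum_r (c r g' : C) *: Rot (g r) (sec h))
     = \sum_r (c r g' : C) *: pi (Rot (g r) (sec h)) by [].
  have hZ r : Z (Rot (g r) (sec h)).
    by apply/bZ/bicocycle_Rot => //; apply/usp2_sp2/Qg.
  elim: (index_enum _) => [|r s [IH1 IH2]].
    by rewrite !big_nil; split; [exact: Z0|exact: pi0].
  by rewrite !big_cons pi_lin // IH2; split=> //; apply: Z_lin.
move=> t k h ht [x [hx kx <-]].
have t0 : t != 0 by rewrite -normr_gt0 ht ltr01.
have hg := sp2_torus t0.
have [y [hy hxy]] := bicocycle_rep hx.
have epi : pi x = pi (x + Qm y).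
  by rewrite pi_add_coboundary //; exists y.
rewrite {1}epi rhoE // (linD (Rot_lin hg)) (Rot_torus t0 kx) Rot_Qm //.
rewrite torus2E !mx2E scale0r addr0 -torus2E -(linZ Qm_lin).
have zx : Z (t ^ k *: x) by apply: (lin_closedZ Z_lin Z0).
rewrite pi_add_coboundary ?piZ //.
by exists (t *: Rot (torus2 t) y) => //; apply/relZ/Rot_rel.
Qed.

End Family.
End Cohomology.

Theorem proposition4p6 (R : realType)
  (n : nat) (G : set 'M[R]_n) (d : nat) (T : 'I_d -> 'M[R]_n)
  (f : 'I_d -> 'I_d -> 'I_d -> R) (K lam : 'M[R]_d)
  (hG : compact_matrix_group G) (hT : compact_lie_basis G T f)
  (hK : normalized_invariant_form f K) (hlam : critical_level_form f K lam)
  (Vk : vertexAlgebra R) (Jk : 'I_d -> Vk) (hVk : universal_affine f lam Jk)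
  (V : vertexAlgebra R) (phi : Vk -> V) (hphi : va_hom phi)
  (Sf : vertexAlgebra R) (etaS : bool * 'I_d -> Sf)
  (hS : symplectic_fermions K etaS)
  (W : vertexAlgebra R) (i : V -> W) (j : Sf -> W) (hW : va_tensor i j)
  (J : 'I_d -> W) (hJ : forall A, J A = i (phi (Jk A)))
  (eta : bool * 'I_d -> W) (heta : forall b, eta b = j (etaS b))
  (theta : 'I_d -> W -> W) (htheta : is_theta f eta theta i)
  (Lam : W -> W) (hLam : is_Lambda eta Lam i)
  (hQQ : QQ_lemma f K J eta theta Lam)
  (H : vertexAlgebra R) (pi : W -> H)
  (hH : relative_cohomology f K J eta theta pi) :
  exists rho : 'M[R[i]]_2 -> H -> H,
    usp2_action rho /\
    (forall (t : R[i]) (k : int) (h : H), `|t| = 1 ->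
       cohomology_degree f K J eta theta i pi k h ->
       rho (torus2 t) h = t ^ k *: h).
Proof.
case: hK => Ksym _ Kinv _.
have hJV A : vpar false (phi (Jk A)).
  by case: hphi hVk => _ hp _ _ [[hJk _ _] _]; apply/hp/hJk.
have /choice[Rot hRot] : forall g, exists F, sp2 g -> is_rotation i eta g F.
  move=> g; have [hg|ng] := pselect (sp2 g); last by exists id.
  by have [F hF] := rotation_exists hS hW heta hg; exists F.
exact: (usp2_action_exists Ksym Kinv hS hW heta hJV hJ hLam htheta hQQ hH hRot).
Qed.
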